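(* Consider the SSBM in the context with $\eta\in[0,1/2)$, $k\ge2$, $n\ge10$, and suppose the aspect ratio satisfies $\sqrt\rho>1-\frac{1}{4k(2+\sqrt k)}$. Let $\delta\in(0,\frac12)$ and suppose $$p>C(k,\eta,\delta)\frac{\ln n}{n},\qquad C(k,\eta,\delta)=\left(\frac{2Ck}{\delta(1-2\eta)}\right)^2,$$ where $C<43$ is a universal constant. Then there exists a universal constant $c>0$ such that, with probability at least $1-\frac2n-n\exp(-\frac{np}{c})$, there exists an orthogonal matrix $O\in\mathbb R^{(k-1)\times(k-1)}$ with $$\|V_{k-1}(\overline{L_{sym}})-\Theta R_{k-1}O\|\le2\delta,$$ where $R_{k-1}\in\mathbb R^{k\times(k-1)}$ has as columns orthonormal eigenvectors of the $k-1$ smallest eigenvalues of the matrix $\bar C$.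
   Context: SSBM: integers $n\ge2,k\ge2$, $p\in(0,1]$, $\eta\in[0,1/2)$, partition of $[n]$ into nonempty clusters $C_1,\dots,C_k$, $|C_i|=n_i$. Independently for each unordered pair $j\ne j'$ an edge is present w.p. $p$, signed $+1$ if $j,j'$ are in the same cluster and $-1$ otherwise, then the sign is flipped independently w.p. $\eta$. $A\in\{0,\pm1\}^{n\times n}$ is the symmetric signed adjacency matrix (zero diagonal), $A^\pm$ its positive/negative parts, $\bar D=\mathrm{diag}((A^++A^-)\mathbf1)$ the signed degree matrix. $s=\min n_i/n$, $l=\max n_i/n$, aspect ratio $\rho=s/l$. $\Theta_{ji}=1/\sqrt{n_i}$ if $j\in C_i$ else 0. Symmetric Signed Laplacian $\overline{L_{sym}}=I-\bar D^{-1/2}A\bar D^{-1/2}$; $V_{k-1}(M)$ denotes an $n\times(k-1)$ matrix of orthonormal eigenvectors for the $k-1$ smallest eigenvalues of $M$; $\|\cdot\|$ spectral norm. With $\bar d=p(n-1)$ and $\bar\alpha=1+\frac{p}{\bar d}(1-2\eta)$, $\bar C=\bar\alpha I_k-\bar B$ where $\bar B_{ii}=\frac{n_ip}{\bar d}(1-2\eta)$ and $\bar B_{ii'}=-\frac{\sqrt{n_in_{i'}}p}{\bar d}(1-2\eta)$ for $i\ne i'$. *)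

(* Defs.v *)
From HB Require Import structures.
From mathcomp Require Import all_boot all_order all_algebra.
From mathcomp Require Import all_classical all_reals all_analysis.
Set Implicit Arguments. Unset Strict Implicit. Unset Printing Implicit Defensive.
Import Order.TTheory GRing.Theory Num.Theory.
Local Open Scope ring_scope.

(* Sample space of the SSBM: for every ordered pair e of vertices, an
   "edge present" bit (e.1 of the value) and a "sign flip" bit (e.2).
   All 2*n^2 bits are independent: presence ~ Bernoulli(p), flip ~ Bernoulli(eta).
   Only the pairs (j, j') with j < j' are used to build the graph, so the
   graph has exactly the law of the SSBM (the remaining bits are irrelevant). *)
Definition outcome (n : nat) := {ffun 'I_n * 'I_n -> bool * bool}.

Definition weight (R : realType) (n : nat) (p eta : R) (w : outcome n) : R :=
  \prod_(e : 'I_n * 'I_n)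
     ((if (w e).1 then p else 1 - p) * (if (w e).2 then eta else 1 - eta)).

Definition prob (R : realType) (n : nat) (p eta : R) (E : outcome n -> Prop) : R :=
  \sum_(w : outcome n | `[< E w >]) weight p eta w.

Definition adj (R : realType) (n k : nat) (cl : 'I_n -> 'I_k) (w : outcome n)
  : 'M[R]_n :=
  \matrix_(j, j')
    if j == j' then 0 else
    let e := if (j < j')%N then (j, j') else (j', j) in
    if (w e).1 then
      (if cl j == cl j' then 1 else -1) * (if (w e).2 then -1 else 1)
    else 0.

(* signed degree of vertex j:  ((A^+ + A^-) 1)_j = sum_j' |A_jj'| *)
Definition sdeg (R : realType) (n : nat) (A : 'M[R]_n) (j : 'I_n) : R :=
  \sum_j' `|A j j'|.

(* Dbar^{-1/2}; convention: an isolated vertex (degree 0) gets entry 0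
   (MathComp's 0^-1 = 0). *)
Definition Dinvsqrt (R : realType) (n : nat) (A : 'M[R]_n) : 'M[R]_n :=
  diag_mx (\row_j (Num.sqrt (sdeg A j))^-1).

Definition Lsym (R : realType) (n : nat) (A : 'M[R]_n) : 'M[R]_n :=
  1%:M - Dinvsqrt A *m A *m Dinvsqrt A.

(* V is an N x m matrix of orthonormal eigenvectors of M for its m smallest
   eigenvalues (counted with multiplicity): the eigenvalues of M listed in
   nondecreasing order are s_0 <= ... <= s_{N-1} (the roots of the
   characteristic polynomial), and column j of V is an eigenvector for s_j. *)
Definition bottom_eigvecs (R : realType) (N m : nat) (M : 'M[R]_N)
  (V : 'M[R]_(N, m)) : Prop :=
  V^T *m V = 1%:M /\
  exists s : seq R,
    [/\ size s = N, sorted <=%R s,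
        char_poly M = \prod_(x <- s) ('X - x%:P) &
        forall j : 'I_m, M *m col j V = (nth 0 s j) *: col j V].

Definition vnorm (R : realType) (N : nat) (v : 'cV[R]_N) : R :=
  Num.sqrt (\sum_i (v i 0) ^+ 2).

Definition opnorm (R : realType) (N M : nat) (X : 'M[R]_(N, M)) : R :=
  sup [set x : R | exists v : 'cV[R]_M, vnorm v <= 1 /\ x = vnorm (X *m v)].

Definition orthogonal_mx (R : realType) (m : nat) (O : 'M[R]_m) : Prop :=
  O^T *m O = 1%:M.

Definition csize (n k : nat) (cl : 'I_n -> 'I_k) (i : 'I_k) : nat :=
  #|[set j | cl j == i]|.

Definition Theta (R : realType) (n k : nat) (cl : 'I_n -> 'I_k) : 'M[R]_(n, k) :=
  \matrix_(j, i) if cl j == i then (Num.sqrt (csize cl i)%:R)^-1 else 0.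

Definition aspect (R : realType) (n k : nat) (cl : 'I_n -> 'I_k) : R :=
  let s := (\big[minn/n]_i csize cl i)%:R / n%:R in
  let l := (\max_i csize cl i)%:R / n%:R in
  s / l.

Definition Cbar (R : realType) (n k : nat) (cl : 'I_n -> 'I_k) (p eta : R)
  : 'M[R]_k :=
  let dbar := p * (n.-1)%:R in
  let alpha := 1 + p / dbar * (1 - 2 * eta) in
  let Bbar := \matrix_(i, i')
     if i == i' then (csize cl i)%:R * p / dbar * (1 - 2 * eta)
     else - (Num.sqrt ((csize cl i)%:R * (csize cl i')%:R) * p / dbar
             * (1 - 2 * eta)) in
  alpha%:M - Bbar.

(* Main.v *)
Require Import Defs.
From HB Require Import structures.
From mathcomp Require Import all_boot all_order all_algebra.
From mathcomp Require Import all_classical all_reals all_analysis.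
From mathcomp Require Import complex ring lra zify.
Set Implicit Arguments. Unset Strict Implicit. Unset Printing Implicit Defensive.
Import Order.TTheory GRing.Theory Num.Theory.
Local Open Scope ring_scope.

(* Fluctuations: for [L = 2 q] with [q] of order [ln n], [E tr (A - E A)^L] is a sum over
   closed walks. By independence a walk contributes only if each of its edges is used at
   least twice, and then at most [beta^L z^D], where [D] is its number of distinct edges and
   [z = p / beta^2]. Prolonging a walk either opens a new edge ([n] choices, factor [z]) or
   reuses one of at most [L] edges, so the sum over walks of [z^D] is at most
   [n (n z + L)^L]. The choice [beta^2 = n p / L] gives [n (2 sqrt (n p L))^L], and Markov's
   inequality bounds the spectral norm by [O(sqrt (n p ln n))] outside an event of
   probability [1 / n]. The same count for stars instead of walks controls the degrees.

   Spectra: the mean Laplacian acts as [Cbar] on the range of [Theta] and as the scalar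
   [alpha] on its orthogonal complement. [Bbar] is a multiple of [2 diag(n_i) - u u^T] with
   [u_i = sqrt n_i]; it is at least [2 min n_i] on the hyperplane orthogonal to [u], and it
   is nonpositive at the vector of entries [1 / sqrt n_i]. Hence the [k - 1] smallest
   eigenvalues of the mean Laplacian lie [1.8 (1 - 2 eta) / k] below the others, and the
   theorem follows from the Courant-Fischer, sin-theta and Procrustes bounds. *)

(** * Euclidean geometry and the real spectral theorem *)

Definition dot {R : realType} {N : nat} (u v : 'cV[R]_N) : R := \sum_i u i 0 * v i 0.

Section Dot.
Variables (R : realType) (N : nat).
Implicit Types (u v w : 'cV[R]_N) (a : R).

Lemma dotE u v : dot u v = (u^T *m v) 0 0.
Proof. by rewrite mxE; apply: eq_bigr => i _; rewrite mxE. Qed.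

Lemma dotC u v : dot u v = dot v u.
Proof. by apply: eq_bigr => i _; rewrite mulrC. Qed.

Lemma dotDl u v w : dot (u + v) w = dot u w + dot v w.
Proof. by rewrite !dotE linearD mulmxDl mxE. Qed.

Lemma dotDr u v w : dot w (u + v) = dot w u + dot w v.
Proof. by rewrite !dotE mulmxDr mxE. Qed.

Lemma dotZl a u v : dot (a *: u) v = a * dot u v.
Proof. by rewrite !dotE linearZ -scalemxAl mxE. Qed.

Lemma dotZr a u v : dot u (a *: v) = a * dot u v.
Proof. by rewrite !dotE -scalemxAr mxE. Qed.

Lemma dotNl u v : dot (- u) v = - dot u v.
Proof. by rewrite -scaleN1r dotZl mulN1r. Qed.

Lemma dotNr u v : dot u (- v) = - dot u v.
Proof. by rewrite -scaleN1r dotZr mulN1r. Qed.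

Lemma dot_ge0 u : 0 <= dot u u.
Proof. by apply: sumr_ge0 => i _; rewrite -expr2 sqr_ge0. Qed.

Lemma dot_eq0 u : (dot u u == 0) = (u == 0).
Proof.
rewrite psumr_eq0 => [|i _]; last by rewrite -expr2 sqr_ge0.
apply/allP/eqP => [u0|-> i _]; last by rewrite mxE mul0r eqxx.
apply/colP => i; rewrite mxE; apply/eqP.
by have := u0 i (mem_index_enum i); rewrite /= mulf_eq0 orbb.
Qed.

Lemma dot_gt0 u : u != 0 -> 0 < dot u u.
Proof. by move=> u0; rewrite lt_neqAle dot_ge0 eq_sym dot_eq0 u0. Qed.

Lemma vnormE u : vnorm u = Num.sqrt (dot u u).
Proof. by congr Num.sqrt; apply: eq_bigr => i _; rewrite expr2. Qed.

Lemma vnorm_ge0 u : 0 <= vnorm u.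
Proof. exact: sqrtr_ge0. Qed.

Lemma vnorm_sqr u : vnorm u ^+ 2 = dot u u.
Proof. by rewrite vnormE sqr_sqrtr // dot_ge0. Qed.

Lemma vnorm_le u a : 0 <= a -> (vnorm u <= a) = (dot u u <= a ^+ 2).
Proof. by move=> a0; rewrite -vnorm_sqr ler_pXn2r // nnegrE vnorm_ge0. Qed.

Lemma vnorm_eq0 u : (vnorm u == 0) = (u == 0).
Proof. by rewrite -sqrf_eq0 vnorm_sqr dot_eq0. Qed.

Lemma vnorm0 : vnorm (0 : 'cV[R]_N) = 0.
Proof.
by apply/eqP; rewrite vnorm_eq0.
Qed.

Lemma vnormZ a u : vnorm (a *: u) = `|a| * vnorm u.
Proof.
by rewrite vnormE dotZl dotZr mulrA -expr2 sqrtrM ?sqr_ge0 // sqrtr_sqr -vnormE.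
Qed.

Lemma dot_le_vnorm u v : dot u v <= vnorm u * vnorm v.
Proof.
have [->|v0] := eqVneq v 0.
  by rewrite vnorm0 mulr0 -(scale0r 0) dotZr mul0r.
have vv := dot_gt0 v0.
have /ger0_norm <- : 0 <= vnorm u * vnorm v by rewrite mulr_ge0 ?vnorm_ge0.
apply: le_trans (ler_norm _) _.
rewrite -ler_sqr ?nnegrE ?normr_ge0 // !real_normK ?num_real // exprMn !vnorm_sqr.
(* Cauchy-Schwarz: the squared norm of this vector is [dot v v] times the Gram determinant of [u]
   and [v]. *)
have := dot_ge0 (dot v v *: u - dot u v *: v).
rewrite !(dotDl, dotDr, dotNl, dotNr, dotZl, dotZr) (dotC v u).
rewrite [X in 0 <= X](_ : _ = dot v v * (dot u u * dot v v - dot u v ^+ 2)); last by ring.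
by rewrite pmulr_rge0 // subr_ge0.
Qed.

Lemma vnormD u v : vnorm (u + v) <= vnorm u + vnorm v.
Proof.
rewrite vnorm_le ?addr_ge0 ?vnorm_ge0 // dotDl !dotDr (dotC v u) sqrrD !vnorm_sqr.
have := dot_le_vnorm u v; lra.
Qed.

End Dot.

Lemma dot_mulmxr (R : realType) (n m : nat) (A : 'M[R]_(n, m)) u v :
  dot u (A *m v) = dot (A^T *m u) v.
Proof. by rewrite !dotE trmx_mul trmxK mulmxA. Qed.

Lemma dot_mulmxl (R : realType) (n m : nat) (A : 'M[R]_(n, m)) u v :
  dot (A *m v) u = dot v (A^T *m u).
Proof. by rewrite dotC dot_mulmxr dotC. Qed.

Lemma dot_isometry (R : realType) (n m : nat) (V : 'M[R]_(n, m)) u v :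
  V^T *m V = 1%:M -> dot (V *m u) (V *m v) = dot u v.
Proof. by move=> VV; rewrite dot_mulmxl mulmxA VV mul1mx. Qed.

Lemma dot_diag (R : realType) (m : nat) (d : 'rV[R]_m) (y : 'cV[R]_m) :
  dot y (diag_mx d *m y) = \sum_i d 0 i * y i 0 ^+ 2.
Proof.
by apply: eq_bigr => i _; rewrite mul_diag_mx mxE expr2 mulrCA.
Qed.

(** An upper bound on the operator norm kept as a predicate: such bounds add and compose without any
    handling of the supremum in [opnorm], which is reached through [opnorm_le]. *)
Definition opbound {R : realType} {n m : nat} (X : 'M[R]_(n, m)) (t : R) :=
  forall v, vnorm (X *m v) <= t * vnorm v.

Section OpBound.
Variables (R : realType).

Lemma opbound_le n m (X : 'M[R]_(n, m)) s t : s <= t -> opbound X s -> opbound X t.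
Proof. by move=> st Xs v; apply: le_trans (Xs v) _; rewrite ler_wpM2r ?vnorm_ge0. Qed.

Lemma opboundD n m (X Y : 'M[R]_(n, m)) s t :
  opbound X s -> opbound Y t -> opbound (X + Y) (s + t).
Proof.
move=> Xs Yt v; rewrite mulmxDl mulrDl; apply: le_trans (vnormD _ _) _.
exact: lerD.
Qed.

Lemma opboundM n m r (X : 'M[R]_(n, m)) (Y : 'M[R]_(m, r)) s t :
  0 <= s -> opbound X s -> opbound Y t -> opbound (X *m Y) (s * t).
Proof.
move=> s0 Xs Yt v; rewrite -mulmxA -mulrA; apply: le_trans (Xs _) _.
by rewrite ler_wpM2l.
Qed.

Lemma opboundZ n m (X : 'M[R]_(n, m)) a t :
  opbound X t -> opbound (a *: X) (`|a| * t).
Proof.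
by move=> Xt v; rewrite -scalemxAl vnormZ -mulrA ler_wpM2l.
Qed.

Lemma opbound_isometry n m (V : 'M[R]_(n, m)) : V^T *m V = 1%:M -> opbound V 1.
Proof. by move=> VV v; rewrite mul1r !vnormE dot_isometry. Qed.

Lemma opbound_diag n (d : 'rV[R]_n) t :
  0 <= t -> (forall i, `|d 0 i| <= t) -> opbound (diag_mx d) t.
Proof.
move=> t0 dt v; rewrite vnorm_le ?mulr_ge0 ?vnorm_ge0 // exprMn vnorm_sqr.
rewrite /dot mulr_sumr; apply: ler_sum => i _.
rewrite mul_diag_mx !mxE -!expr2 exprMn ler_wpM2r ?sqr_ge0 //.
by rewrite -(real_normK (num_real (d 0 i))) ler_pXn2r ?nnegrE ?normr_ge0.
Qed.

Lemma opnorm_le n m (X : 'M[R]_(n, m)) t : 0 <= t -> opbound X t -> opnorm X <= t.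
Proof.
move=> t0 Xt; apply: ge_sup.
  by exists 0; exists 0; rewrite mulmx0 !vnorm0.
move=> _ [v [v1 ->]]; apply: le_trans (Xt v) _.
by rewrite ler_piMr.
Qed.

End OpBound.

Section Spectral.
Variable R : realType.

(** The polynomial splits over the complex numbers. A root [z] with left eigenvector [v] satisfies
    [z |v|^2 = z^* |v|^2] by symmetry, hence is real, and the factorization descends to the
    reals. *)
Lemma sym_char_poly_split n (S : 'M[R]_n) : S^T = S ->
  exists s : seq R, char_poly S = \prod_(x <- s) ('X - x%:P).
Proof.
move=> symS; pose f := real_complex R.
have real_f x : f x \is Num.real by rewrite complex_real.
have [s] := closed_field_poly_normal (char_poly (map_mx f S)).
rewrite (monicP (char_poly_monic _)) scale1r => chS.
have real_s z : z \in s -> f (complex.Re z) = z.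
  move=> zs; apply: RRe_real; apply/CrealP.
  have : root (char_poly (map_mx f S)) z by rewrite chS root_prod_XsubC.
  rewrite -eigenvalue_root_char => /eigenvalueP[v vS v0].
  pose w := map_mx Num.conj v.
  have wS : map_mx f S *m w^T = z^* *: w^T.
    apply: (can_inj (@trmxK _ _ _)); rewrite trmx_mul linearZ /= !trmxK map_trmx symS.
    have -> : z^* *: w = map_mx Num.conj (z *: v).
      by apply/rowP => i; rewrite !mxE rmorphM.
    rewrite -vS map_mxM; congr (_ *m _).
    by apply/matrixP => i j; rewrite !mxE; apply/esym/conj_Creal.
  have : z * (v *m w^T) 0 0 = z^* * (v *m w^T) 0 0.
    have : (v *m map_mx f S) *m w^T = v *m (map_mx f S *m w^T) by rewrite mulmxA.
    by rewrite vS wS -scalemxAl -scalemxAr => /matrixP/(_ 0 0); rewrite !mxE.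
  move/eqP; rewrite -subr_eq0 -mulrBl mulf_eq0 subr_eq0 => /orP[/eqP/esym //|].
  rewrite mxE psumr_eq0 => [vw|i _]; last by rewrite !mxE mul_conjC_ge0.
  case/negP: v0; apply/eqP/rowP => i; rewrite mxE; apply/eqP.
  rewrite -mul_conjC_eq0.
  by have := allP vw i (mem_index_enum i); rewrite /= !mxE.
exists (map (@complex.Re R) s); apply: (map_poly_inj f).
rewrite map_char_poly chS big_map rmorph_prod /=.
rewrite [LHS]big_seq [RHS]big_seq; apply: eq_bigr => z zs.
by rewrite -[in LHS](real_s z zs) rmorphB /= map_polyX map_polyC.
Qed.

(* The Householder reflection exchanging [u] and the first basis vector. *)
Lemma unit_vector_completion n (u : 'cV[R]_(1 + n)) : dot u u = 1 ->
  exists P : 'M[R]_(1 + n), [/\ P^T = P, P *m P = 1%:M & P *m delta_mx 0 0 = u].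
Proof.
move=> u1; set e : 'cV[R]_(1 + n) := delta_mx 0 0.
have [<-|ne] := eqVneq e u.
  by exists 1%:M; rewrite trmx1 !mul1mx.
pose w := e - u.
have ee : dot e e = 1.
  rewrite /dot (bigD1 0) //= big1 => [|i i0]; rewrite !mxE ?eqxx ?mulr1 ?addr0 //.
  by rewrite (negPf i0) mul0r.
have ww : dot w w = 2 * dot w e.
  rewrite !(dotDl, dotDr, dotNl, dotNr) ee u1 (dotC u e); ring.
have w0 : dot w w != 0 by rewrite dot_eq0 subr_eq0.
have wwM : w^T *m w = (dot w w)%:M by rewrite dotE; apply: mx11_scalar.
have weM : w^T *m e = (dot w e)%:M by rewrite dotE; apply: mx11_scalar.
have [c cw] : exists c, c * dot w w = 2 by exists (2 / dot w w); rewrite divfK.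
exists (1%:M - c *: (w *m w^T)); split.
- by rewrite linearB linearZ /= trmx1 trmx_mul trmxK.
- rewrite mulmxBl mul1mx mulmxBr mulmx1 -!scalemxAl -!scalemxAr scalerA.
  rewrite mulmxA -(mulmxA w) wwM mul_mx_scalar -scalemxAl scalerA.
  rewrite opprB -addrA [X in _ + X](_ : _ = 0) ?addr0 //.
  rewrite addrA -!scaleNr -!scalerDl.
  rewrite [X in X *: _](_ : _ = 0) ?scale0r //.
  by rewrite -mulrA cw; ring.
- rewrite mulmxBl mul1mx -scalemxAl -mulmxA weM mul_mx_scalar scalerA.
  have -> : c * dot w e = 1 by apply: (@mulfI _ 2) => //; rewrite mulrCA -ww cw mulr1.
  by rewrite scale1r /w opprB addrC subrK.
Qed.

Lemma char_poly_conj n (P S : 'M[R]_n) : P *m P = 1%:M ->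
  char_poly (P *m S *m P) = char_poly S.
Proof.
move=> PP; rewrite /char_poly /char_poly_mx.
pose Q := map_mx (@polyC R) P.
have QQ : Q *m Q = 1%:M by rewrite -map_mxM PP map_mx1.
have -> : 'X%:M - map_mx polyC (P *m S *m P) = Q *m ('X%:M - map_mx polyC S) *m Q.
  by rewrite !map_mxM mulmxBr mulmxBl scalar_mxC -(mulmxA _ Q Q) QQ mulmx1.
by rewrite !det_mulmx mulrAC -det_mulmx QQ det1 mul1r.
Qed.

Lemma char_poly_block_diag n (x : R) (S : 'M[R]_n) :
  char_poly (block_mx x%:M 0 0 S : 'M[R]_(1 + n)) = ('X - x%:P) * char_poly S.
Proof.
rewrite /char_poly /char_poly_mx map_block_mx !map_mx0 scalar_mx_block.
rewrite opp_block_mx add_block_mx !subr0 det_ublock; congr (_ * _).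
by rewrite map_scalar_mx -rmorphB det_scalar1.
Qed.

(** Induction on the dimension: a reflection moves a unit eigenvector for the head of [s] to the
    first basis vector, and symmetry leaves a block with the tail of [s] as roots. The list is
    prescribed so that the eigenvalues come out in the order fixed by [bottom_eigvecs]. *)
Lemma sym_diag n (S : 'M[R]_n) (s : seq R) : S^T = S ->
  char_poly S = \prod_(x <- s) ('X - x%:P) ->
  exists Q : 'M[R]_n, Q^T *m Q = 1%:M /\ S = Q *m diag_mx (\row_i s`_i) *m Q^T.
Proof.
elim: n S s => [|n IHn] S s symS chS.
  by exists 1%:M; rewrite trmx1 mulmx1; split=> //; apply/matrixP => -[].
case: s chS => [|x s] chS.
  by have := size_char_poly S; rewrite chS big_nil size_poly1.
have : root (char_poly S) x by rewrite chS root_prod_XsubC mem_head.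
rewrite -eigenvalue_root_char => /eigenvalueP[v vS v0].
pose u := (vnorm v^T)^-1 *: v^T.
have u1 : dot u u = 1.
  by rewrite dotZl dotZr -vnorm_sqr expr2 mulrA mulrACA mulVf ?mulr1 // vnorm_eq0 trmx_eq0.
have Su : S *m u = x *: u.
  have Sv : S *m v^T = x *: v^T by rewrite -[in LHS]symS -trmx_mul vS linearZ.
  by rewrite -scalemxAr Sv !scalerA mulrC.
have [P [PT PP Pe]] := @unit_vector_completion n u u1.
pose B : 'M[R]_(1 + n) := P *m S *m P.
have BT : B^T = B by rewrite /B !trmx_mul PT symS mulmxA.
have Be : B *m delta_mx 0 0 = x *: (delta_mx 0 0 : 'cV[R]_(1 + n)).
  by rewrite /B -!mulmxA Pe Su -scalemxAr -Pe mulmxA PP mul1mx.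
have chBS : char_poly B = char_poly S by apply: char_poly_conj.
have SB : S = P *m B *m P by rewrite /B !mulmxA PP mul1mx -mulmxA PP mulmx1.
clearbody B.
have Bi0 i : B i 0 = x * (i == 0)%:R.
  move/matrixP: Be => /(_ i 0); rewrite !mxE andbT => <-.
  rewrite (bigD1 0) //= big1 => [|j j0]; rewrite !mxE ?eqxx ?mulr1 ?addr0 //.
  by rewrite (negPf j0) mulr0.
have B0i i : B 0 i = x * (i == 0)%:R by rewrite -BT mxE Bi0.
have Bblock : B = block_mx x%:M 0 0 (drsubmx B).
  rewrite -[LHS]submxK; congr block_mx.
  - by apply/matrixP => i j; rewrite !ord1 !mxE lshift0 Bi0 eqxx mulr1 mulr1n.
  - by apply/matrixP => i j; rewrite ord1 !mxE lshift0 B0i mulr0.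
  - by apply/matrixP => i j; rewrite ord1 !mxE lshift0 Bi0 mulr0.
have chB : char_poly (drsubmx B) = \prod_(y <- s) ('X - y%:P).
  apply: (@mulfI _ ('X - x%:P)); first by rewrite polyXsubC_eq0.
  by rewrite -char_poly_block_diag -Bblock chBS chS big_cons.
have [|Q [QQ defB]] := IHn (drsubmx B) s _ chB; first by rewrite trmx_drsub BT.
pose Qb : 'M[R]_(1 + n) := block_mx 1%:M 0 0 Q.
have QbT : Qb^T = block_mx 1%:M 0 0 Q^T by rewrite tr_block_mx !trmx0 trmx1.
have QbQb : Qb^T *m Qb = 1%:M.
  rewrite QbT mulmx_block !(mul0mx, mulmx0, mul1mx, addr0, add0r) QQ.
  by rewrite -scalar_mx_block.
have BE : B = Qb *m block_mx x%:M 0 0 (diag_mx (\row_i s`_i)) *m Qb^T.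
  rewrite Bblock defB QbT !mulmx_block.
  by rewrite !(mul0mx, mulmx0, mul1mx, mulmx1, addr0, add0r).
have sE : diag_mx (\row_i (x :: s)`_i) = block_mx x%:M 0 0 (diag_mx (\row_i s`_i))
    :> 'M[R]_(1 + n).
  rewrite -[X in diag_mx X](@hsubmxK _ 1 1 n) diag_mx_row.
  congr (block_mx _ _ _ (diag_mx _)).
    by apply/matrixP => i j; rewrite !ord1 !mxE.
  by apply/rowP => i; rewrite !mxE.
exists (P *m Qb); split.
  by rewrite trmx_mul PT mulmxA -(mulmxA _ P P) PP mulmx1.
by rewrite sE SB BE trmx_mul PT !mulmxA.
Qed.

Lemma spectral n (S : 'M[R]_n) : S^T = S -> exists (Q : 'M[R]_n) (d : 'rV[R]_n),
  [/\ Q^T *m Q = 1%:M, Q *m Q^T = 1%:M & S = Q *m diag_mx d *m Q^T].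
Proof.
move=> symS; have [s /(sym_diag symS)[Q [QQ SE]]] := sym_char_poly_split symS.
by exists Q, (\row_i s`_i); split=> //; apply: mulmx1C.
Qed.

End Spectral.

(** * Courant-Fischer, sin-theta and Procrustes bounds *)

Section SpectralBounds.
Variable R : realType.

Lemma dot_spectral n (Q : 'M[R]_n) (d : 'rV[R]_n) v :
  dot v (Q *m diag_mx d *m Q^T *m v) = \sum_i d 0 i * (Q^T *m v) i 0 ^+ 2.
Proof. by rewrite -dot_diag -!mulmxA dot_mulmxr. Qed.

Lemma dot_orthogonal n (Q : 'M[R]_n) v : Q^T *m Q = 1%:M ->
  dot v v = \sum_i (Q^T *m v) i 0 ^+ 2.
Proof.
by move=> /mulmx1C QQ; rewrite -[dot v v](@dot_isometry _ _ _ Q^T) ?trmxK.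
Qed.

(** A top eigenvector of [Y^T Y] attains the norm of [Y]; an operator bound then reduces to an
    estimate at one unit vector. *)
Lemma max_singular n m (Y : 'M[R]_(n, m)) : (0 < m)%N ->
  exists x, vnorm x = 1 /\ opbound Y (vnorm (Y *m x)).
Proof.
case: m Y => // m Y _.
have [|Q [d [QQ _ YE]]] := @spectral R m.+1 (Y^T *m Y).
  by rewrite trmx_mul trmxK.
have YQ z : dot (Y *m z) (Y *m z) = \sum_i d 0 i * (Q^T *m z) i 0 ^+ 2.
  by rewrite dot_mulmxl mulmxA YE dot_spectral.
have [i _ di] := @Order.TotalTheory.arg_maxP _ _ 'I_m.+1 ord0 xpredT (d 0) isT.
have e1 : dot (delta_mx i 0 : 'cV[R]_m.+1) (delta_mx i 0) = 1.
  rewrite /dot (bigD1 i) //= big1 => [|j ji]; rewrite !mxE ?eqxx ?mulr1 ?addr0 //.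
  by rewrite (negPf ji) mul0r.
exists (Q *m delta_mx i 0); split.
  by rewrite vnormE dot_isometry // e1 sqrtr1.
move=> z; rewrite vnorm_le ?mulr_ge0 ?vnorm_ge0 // exprMn !vnorm_sqr !YQ.
rewrite (dot_orthogonal z QQ) [X in _ <= X * _](_ : _ = d 0 i).
  by rewrite mulr_sumr ler_sum // => j _; rewrite ler_wpM2r ?sqr_ge0 //; exact: (di j isT).
rewrite mulmxA QQ mul1mx (bigD1 i) //= big1 => [|j ji]; rewrite !mxE ?eqxx ?expr1n ?mulr1 ?addr0 //.
by rewrite (negPf ji) expr0n mulr0.
Qed.

(** The trace is the sum of the even powers of the eigenvalues, all nonnegative, so it dominates
    each of them. *)
Lemma opbound_trace_pow n (S : 'M[R]_n) q t : S^T = S -> (0 < q)%N -> 0 <= t ->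
  \tr (S ^+ (2 * q)) <= t ^+ (2 * q) -> opbound S t.
Proof.
move=> /spectral[Q [d [QQ QQ' ->]]] q0 t0 trS.
have powS k : (Q *m diag_mx d *m Q^T) ^+ k = Q *m diag_mx (\row_i d 0 i ^+ k) *m Q^T.
  elim: k => [|k IHk].
    rewrite expr0 [X in diag_mx X](_ : _ = const_mx 1).
      by rewrite diag_const_mx mulmx1 QQ'.
    by apply/rowP => i; rewrite !mxE.
  rewrite exprS IHk -mulmxE !mulmxA -(mulmxA _ Q^T Q) QQ mulmx1.
  rewrite -(mulmxA Q (diag_mx d)) mulmx_diag; congr (_ *m diag_mx _ *m _).
  by apply/rowP => i; rewrite !mxE exprS.
have pow_ge0 (x : R) : 0 <= x ^+ (2 * q) by rewrite exprM exprn_ge0 ?sqr_ge0.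
have d_le i : `|d 0 i| <= t.
  rewrite -(@ler_pXn2r _ (2 * q)) ?nnegrE ?normr_ge0 ?muln_gt0 //.
  apply: le_trans trS; rewrite powS mxtrace_mulC mulmxA QQ mul1mx mxtrace_diag.
  rewrite (bigD1 i) //= mxE -normrX ger0_norm ?pow_ge0 //.
  by rewrite lerDl sumr_ge0 // => j _; rewrite mxE.
have := opboundM ler01 (opbound_isometry QQ) (opbound_diag t0 d_le).
rewrite mul1r => /(opboundM t0)/(_ (@opbound_isometry _ _ _ Q^T _)).
by rewrite mulr1 trmxK; apply.
Qed.

(** The range of [A] has dimension [r > j], so it contains a nonzero vector orthogonal to the first
    [j] eigenvectors; its Rayleigh quotient is at least [s_j]. *)
Lemma courant_fischer n r (S Q : 'M[R]_n) (s : seq R) (A : 'M[R]_(n, r)) j a :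
  Q^T *m Q = 1%:M -> S = Q *m diag_mx (\row_i s`_i) *m Q^T ->
  size s = n -> sorted <=%R s -> (j < r)%N -> (j < n)%N ->
  (forall y : 'cV[R]_r, A *m y = 0 -> y = 0) ->
  (forall y, dot (A *m y) (S *m (A *m y)) <= a * dot (A *m y) (A *m y)) ->
  s`_j <= a.
Proof.
move=> QQ SE sz srt jr jn Ainj Aa.
pose K : 'M[R]_(j, r) := \matrix_(i, l) (Q^T *m A) (widen_ord (ltnW jn) i) l.
have : kermx K^T != 0.
  rewrite -mxrank_eq0 mxrank_ker subn_eq0 -ltnNge.
  by apply: leq_ltn_trans jr; apply: rank_leq_col.
case/rowV0Pn => y0 /sub_kermxP y0K y0n.
pose v := A *m y0^T.
have v0 : 0 < dot v v.
  apply: dot_gt0; apply: contra_neq y0n => /Ainj /eqP; rewrite trmx_eq0 => /eqP //.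
have Kv : K *m y0^T = 0 by rewrite -[LHS]trmxK trmx_mul trmxK y0K trmx0.
have KE : K *m y0^T = \col_i (Q^T *m v) (widen_ord (ltnW jn) i) 0.
  apply/colP => i; rewrite [RHS]mxE /v mulmxA [LHS]mxE [RHS]mxE.
  by apply: eq_bigr => l _; rewrite [K i l]mxE.
have zlt (i : 'I_n) : (i < j)%N -> (Q^T *m v) i 0 = 0.
  move=> ij; move/colP: Kv => /(_ (Ordinal ij)); rewrite KE mxE [RHS]mxE.
  by rewrite (_ : widen_ord _ _ = i) //; apply: val_inj.
have := Aa y0^T; rewrite -/v SE dot_spectral => le_a.
rewrite -(ler_pM2r v0); apply: le_trans le_a; rewrite (dot_orthogonal v QQ) mulr_sumr.
apply: ler_sum => i _; case: (ltnP i j) => [ij|ji].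
  by rewrite zlt // expr0n !mulr0.
rewrite ler_wpM2r ?sqr_ge0 // mxE.
by apply: (sorted_leq_nth le_trans le_refl 0 srt) => //; rewrite inE sz ?ltn_ord.
Qed.

(** A Davis-Kahan bound. With [Y] the part of [V] orthogonal to [U] and [y = Y x] of maximal norm
    [N], the form of [L0] at [y] is at least [b N^2] and at most [a N^2 + t N]. *)
Lemma sin_theta n m (L L0 : 'M[R]_n) (V U : 'M[R]_(n, m)) (lam : 'rV[R]_m) (M : 'M[R]_m)
    (a b t : R) :
  V^T *m V = 1%:M -> U^T *m U = 1%:M ->
  L *m V = V *m diag_mx lam -> L0 *m U = U *m M ->
  (forall i, lam 0 i <= a) -> a < b ->
  (forall w, U^T *m w = 0 -> b * dot w w <= dot w (L0 *m w)) ->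
  0 <= t -> opbound (L0 - L) t ->
  opbound (V - U *m (U^T *m V)) (t / (b - a)).
Proof.
move=> VV UU LV LU lam_a ab L0b t0 Lt.
case: m V U lam M VV UU LV LU lam_a L0b => [|m] V U lam M VV UU LV LU lam_a L0b.
  move=> v; rewrite [v](_ : _ = 0) ?mulmx0 ?vnorm0 ?mulr0 //.
  by apply/matrixP => -[].
set Y := V - _.
have [x [x1 Yx]] := @max_singular n m.+1 Y isT.
set y := Y *m x in Yx; set N := vnorm y in Yx.
apply: (opbound_le _ Yx); rewrite ler_pdivlMr ?subr_gt0 //.
have UY : U^T *m Y = 0 by rewrite mulmxBr (mulmxA U^T U) UU mul1mx subrr.
have Uy : U^T *m y = 0 by rewrite mulmxA UY mul0mx.
have yU z : dot y (U *m z) = 0.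
  by rewrite dot_mulmxr Uy /dot big1 // => i _; rewrite mxE mul0r.
have VY z : V *m z = Y *m z + U *m (U^T *m V *m z).
  by rewrite mulmxBl !mulmxA subrK.
have yV z : dot y (V *m z) = dot y (Y *m z) by rewrite VY dotDr yU addr0.
(* Shifting by [a - r] puts the eigenvalues in [[0, r]], where the norm of [Y] gives [N^2 r]; adding
   the shift back leaves [a N^2], so a one-sided bound on [lam] suffices. *)
pose r := \sum_i (a - lam 0 i).
have r0 i : a - lam 0 i <= r.
  rewrite /r (bigD1 i) //= lerDl sumr_ge0 // => j _.
  by rewrite subr_ge0.
have r_ge0 : 0 <= r by apply: sumr_ge0 => j _; rewrite subr_ge0.
have NN : dot y y = N ^+ 2 by rewrite vnorm_sqr.
pose D := diag_mx (\row_i (lam 0 i - (a - r))).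
have Dr : opbound D r.
  apply: opbound_diag => // i; rewrite mxE; have := r0 i; have := lam_a i.
  by move=> h1 h2; rewrite ler_norml; apply/andP; split; lra.
have lamD : diag_mx lam = D + (a - r)%:M.
  rewrite -diag_const_mx -linearD /=; congr diag_mx.
  by apply/rowP => i; rewrite !mxE subrK.
(* Pairing with [y] kills every term in the range of [U] and turns [V] into [Y]. *)
have L0y : dot y (L0 *m y) =
    dot y (Y *m (D *m x)) + (a - r) * N ^+ 2 + dot y ((L0 - L) *m (V *m x)).
  have -> : L0 *m y = V *m (diag_mx lam *m x) + (L0 - L) *m (V *m x)
      - U *m (M *m (U^T *m V *m x)).
    have -> : V *m (diag_mx lam *m x) = L *m (V *m x) by rewrite !mulmxA LV.
    have -> : U *m (M *m (U^T *m V *m x)) = L0 *m (U *m (U^T *m V *m x)).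
      by rewrite (mulmxA U) -LU -mulmxA.
    by rewrite mulmxBl [L *m _ + _]addrC subrK (VY _ x) mulmxDr addrK.
  rewrite dotDr dotNr yU subr0 dotDr yV lamD (mulmxDl D) mulmxDr dotDr.
  by rewrite mul_scalar_mx -scalemxAr dotZr -/y NN.
have := L0b y Uy; rewrite L0y NN => le1.
have le2 : dot y (Y *m (D *m x)) <= N * (N * r).
  apply: le_trans (dot_le_vnorm _ _) _; rewrite ler_wpM2l ?vnorm_ge0 //.
  apply: le_trans (Yx _) _; rewrite ler_wpM2l ?vnorm_ge0 //.
  by have := Dr x; rewrite x1 mulr1.
have le3 : dot y ((L0 - L) *m (V *m x)) <= N * t.
  apply: le_trans (dot_le_vnorm _ _) _; rewrite ler_wpM2l ?vnorm_ge0 //.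
  apply: le_trans (Lt _) _.
  by have -> : vnorm (V *m x) = 1; rewrite ?mulr1 // vnormE dot_isometry // -vnormE.
have [->|N0] := eqVneq N 0; first by rewrite mul0r.
have N_gt0 : 0 < N by rewrite lt_neqAle eq_sym N0 vnorm_ge0.
rewrite -(ler_pM2l N_gt0); nra.
Qed.

(* The minimizing [O] is the orthogonal factor of the polar decomposition of [U^T V]. *)
Lemma procrustes n m (V U : 'M[R]_(n, m)) (t : R) :
  V^T *m V = 1%:M -> U^T *m U = 1%:M -> 0 <= t -> t < 1 ->
  opbound (V - U *m (U^T *m V)) t ->
  exists O : 'M[R]_m, orthogonal_mx O /\ opbound (V - U *m O) (2 * t).
Proof.
move=> VV UU t0 t1 Yt.
set Y := V - _ in Yt.
pose G := U^T *m V.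
have UY : U^T *m Y = 0 by rewrite mulmxBr (mulmxA U^T U) UU mul1mx subrr.
have [|Q [d [QQ QQ' GE]]] := @spectral R m (G^T *m G).
  by rewrite trmx_mul trmxK.
have VG z : dot z z = dot (Y *m z) (Y *m z) + dot (G *m z) (G *m z).
  have YU : dot (Y *m z) (U *m (G *m z)) = 0.
    by rewrite dot_mulmxr mulmxA UY mul0mx /dot big1 // => i _; rewrite mxE mul0r.
  rewrite -(dot_isometry z z VV) (_ : V *m z = Y *m z + U *m (G *m z)).
    by rewrite dotDl !dotDr YU (dotC (U *m _)) YU (dot_isometry _ _ UU) addr0 add0r.
  by rewrite mulmxBl !mulmxA subrK.
have YG : Y = V - U *m G by [].
clearbody Y; clearbody G.
have GQ z : dot (G *m (Q *m z)) (G *m (Q *m z)) = \sum_i d 0 i * z i 0 ^+ 2.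
  by rewrite dot_mulmxl mulmxA GE dot_spectral mulmxA QQ mul1mx.
(* By Pythagoras [|G z|^2 = |z|^2 - |Y z|^2], which locates the spectrum of [G^T G]; it is positive
   since [t < 1]. *)
have d_bounds i : 1 - t ^+ 2 <= d 0 i <= 1.
  pose e : 'cV[R]_m := delta_mx i 0.
  have ee : dot e e = 1.
    rewrite /dot (bigD1 i) //= big1 => [|j ji]; rewrite !mxE ?eqxx ?mulr1 ?addr0 //.
    by rewrite (negPf ji) mul0r.
  have di : dot (G *m (Q *m e)) (G *m (Q *m e)) = d 0 i.
    rewrite GQ (bigD1 i) //= big1 => [|j ji]; rewrite !mxE ?eqxx ?expr1n ?mulr1 ?addr0 //.
    by rewrite (negPf ji) expr0n mulr0.
  have := VG (Q *m e); rewrite dot_isometry // ee di.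
  have := Yt (Q *m e); rewrite [vnorm (Q *m e)]vnormE dot_isometry // ee sqrtr1 mulr1.
  by rewrite vnorm_le // => h1 h2; have := dot_ge0 (Y *m (Q *m e)); lra.
have tt : t ^+ 2 < 1 by rewrite expr_lt1.
have d_gt0 i : 0 < d 0 i by have := d_bounds i; lra.
pose h i := Num.sqrt (d 0 i).
have hh i : h i ^+ 2 = d 0 i by rewrite sqr_sqrtr // ltW.
have h_gt0 i : 0 < h i by rewrite sqrtr_gt0.
pose H := diag_mx (\row_i (h i)^-1).
exists (G *m Q *m H *m Q^T); split.
  rewrite /orthogonal_mx !trmx_mul trmxK tr_diag_mx !mulmxA -(mulmxA _ G^T G) GE.
  rewrite !mulmxA -(mulmxA _ Q^T Q) QQ mulmx1 -(mulmxA _ Q^T Q) QQ mulmx1.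
  rewrite -(mulmxA Q) mulmx_diag -(mulmxA Q) mulmx_diag -QQ'; congr (_ *m _).
  rewrite [X in diag_mx X](_ : _ = const_mx 1) ?diag_const_mx ?mulmx1 //.
  apply/rowP => i; rewrite !mxE -hh expr2 mulrA mulVf ?gt_eqF // mul1r divff //.
  by rewrite gt_eqF.
(* The second term has singular values [1 - h], and [1 - h <= 1 - h^2 <= t^2 <= t]; each term thus
   costs [t]. *)
have -> : V - U *m (G *m Q *m H *m Q^T) = Y + U *m (G *m (Q *m (1%:M - H) *m Q^T)).
  rewrite YG (mulmxBr Q) mulmx1 mulmxBl QQ' !(mulmxBr, mulmx1) !mulmxA.
  by rewrite addrA subrK.
rewrite mulr_natl mulr2n; apply: opboundD => // v.
rewrite vnorm_le ?mulr_ge0 ?vnorm_ge0 // -!mulmxA (dot_isometry _ _ UU).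
rewrite exprMn vnorm_sqr (dot_orthogonal v QQ) GQ mulr_sumr ler_sum // => i _.
rewrite [(1%:M - H) *m _](_ : _ = diag_mx (\row_i (1 - (h i)^-1)) *m (Q^T *m v)).
  rewrite mul_diag_mx [X in X ^+ 2]mxE !mxE exprMn mulrA ler_wpM2r ?sqr_ge0 //.
  rewrite -hh -exprMn mulrBr mulr1 divff ?gt_eqF //.
  have := d_bounds i; rewrite -hh => /andP[b1 b2].
  have h1 : h i <= 1 by rewrite -(@expr_le1 _ 2) // ltW.
  have hp := h_gt0 i.
  have : 0 <= (1 - h i) by lra.
  have : (1 - h i) <= t by nra.
  nra.
congr (_ *m _); apply/matrixP => k l; rewrite !mxE.
by case: eqP => [->|_]; rewrite ?mulr1n ?mulr0n ?subr0.
Qed.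

End SpectralBounds.

(** * Moments of sums over walks in the signed stochastic block model *)

Section Expectation.
Variables (R : realType) (n : nat) (p eta : R).
Hypotheses (p0 : 0 <= p) (p1 : p <= 1) (eta0 : 0 <= eta) (eta1 : eta <= 1).
Local Notation E := ('I_n * 'I_n)%type.

Definition bit_weight (b : bool * bool) : R :=
  (if b.1 then p else 1 - p) * (if b.2 then eta else 1 - eta).

Definition expect (f : outcome n -> R) : R := \sum_w weight p eta w * f w.

Lemma sum_bits (f : bool * bool -> R) :
  \sum_b f b = f (true, true) + f (true, false) + (f (false, true) + f (false, false)).
Proof.
transitivity (\sum_b1 \sum_b2 f (b1, b2)); last by rewrite !big_bool.
by rewrite pair_bigA; apply: eq_bigr => -[].
Qed.

Lemma bit_weight_ge0 b : 0 <= bit_weight b.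
Proof. by rewrite /bit_weight mulr_ge0 //; case: ifP => _ //; rewrite subr_ge0. Qed.

Lemma sum_bit_weight : \sum_b bit_weight b = 1.
Proof. rewrite sum_bits /bit_weight /=; ring. Qed.

Lemma weight_ge0 (w : outcome n) : 0 <= weight p eta w :> R.
Proof. by apply: prodr_ge0 => e _; apply: bit_weight_ge0. Qed.

(** Independence of the pairs of bits, in the form of distributivity of products over sums. *)
Lemma expect_prod (f : E -> bool * bool -> R) :
  expect (fun w => \prod_e f e (w e)) = \prod_e \sum_b bit_weight b * f e b.
Proof.
by rewrite bigA_distr_bigA; apply: eq_bigr => w _; rewrite -big_split.
Qed.

Lemma expect1 : expect (fun=> 1) = 1.
Proof.
transitivity (expect (fun w => \prod_(e : E) (fun _ _ => 1) e (w e))).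
  by apply: eq_bigr => w _; rewrite big1.
rewrite (expect_prod (fun _ _ => 1)) big1 // => e _; rewrite -[RHS]sum_bit_weight.
by apply: eq_bigr => b _; rewrite mulr1.
Qed.

Lemma expect_sum (I : finType) (f : I -> outcome n -> R) :
  expect (fun w => \sum_i f i w) = \sum_i expect (f i).
Proof.
by rewrite exchange_big; apply: eq_bigr => w _; rewrite mulr_sumr.
Qed.

Lemma expectD f g : expect (fun w => f w + g w) = expect f + expect g.
Proof. by rewrite -big_split; apply: eq_bigr => w _; rewrite mulrDr. Qed.

Lemma expectZ a f : expect (fun w => a * f w) = a * expect f.
Proof. by rewrite mulr_sumr; apply: eq_bigr => w _; rewrite mulrCA. Qed.

(** Markov's inequality: outside [A] the function [g] is at least 1. *)
Lemma prob_ge (A : outcome n -> Prop) (g : outcome n -> R) :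
  (forall w, 0 <= g w) -> (forall w, g w < 1 -> A w) ->
  1 - expect g <= prob p eta A.
Proof.
move=> g0 gA; rewrite lerBlDr -expect1 /prob big_mkcond -big_split.
apply: ler_sum => w _; case: asboolP => [Aw|nA].
  by rewrite mulr1 /= lerDl mulr_ge0 ?weight_ge0.
rewrite /= add0r ler_wpM2l ?weight_ge0 //.
by rewrite leNgt; apply/negP => /gA.
Qed.

Lemma prod_seq_count (F : E -> R) (es : seq E) :
  \prod_(e <- es) F e = \prod_e F e ^+ count_mem e es.
Proof.
elim: es => [|e es IHes]; first by rewrite big_nil big1.
rewrite big_cons IHes /=; under [RHS]eq_bigr do rewrite exprD.
rewrite [RHS]big_split /=; congr (_ * _).
rewrite (bigD1 e) //= eqxx expr1 big1 ?mulr1 //.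
by move=> e' e'e; rewrite eq_sym (negPf e'e).
Qed.

Lemma prod_mem_undup (z : R) (es : seq E) :
  \prod_e (if e \in es then z else 1) = z ^+ size (undup es).
Proof.
rewrite -big_mkcond prodr_const; congr (_ ^+ _).
by rewrite -(card_uniqP (undup_uniq es)); apply: eq_card => e; rewrite mem_undup.
Qed.

Section Moments.
Variables (y : E -> bool * bool -> R) (beta : R).
Hypotheses (y_mean : forall e, \sum_b bit_weight b * y e b = 0)
  (y_var : forall e, \sum_b bit_weight b * y e b ^+ 2 <= p)
  (y_bound : forall e b, `|y e b| <= 2) (beta2 : 2 <= beta).

(** The first moment vanishes; for [m >= 2], all but two factors are bounded by [beta] and the
    variance supplies [p]. The free parameter [beta] trades a price per letter against a gain per
    distinct edge. *)
Lemma moment_le e m : (0 < m)%N ->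
  `|\sum_b bit_weight b * y e b ^+ m| <= beta ^+ m * (p / beta ^+ 2).
Proof.
have b0 : 0 < beta by apply: lt_le_trans beta2.
case: m => // -[|m] _.
  under eq_bigr do rewrite expr1.
  by rewrite y_mean normr0 mulr_ge0 ?divr_ge0 ?exprn_ge0 // ltW.
apply: le_trans (ler_norm_sum _ _ _) _.
apply: (@le_trans _ _ (beta ^+ m * \sum_b bit_weight b * y e b ^+ 2)).
  rewrite mulr_sumr; apply: ler_sum => b _.
  rewrite normrM (ger0_norm (bit_weight_ge0 b)) mulrCA ler_wpM2l ?bit_weight_ge0 //.
  rewrite -addn2 exprD normrM (ger0_norm (sqr_ge0 _)) ler_wpM2r ?sqr_ge0 //.
  rewrite normrX lerXn2r ?nnegrE // ?(ltW b0) //.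
  exact: le_trans (y_bound _ _) beta2.
have -> : beta ^+ m.+2 * (p / beta ^+ 2) = beta ^+ m * p.
  by rewrite -addn2 exprD; field; rewrite gt_eqF.
by rewrite ler_wpM2l // exprn_ge0 // ltW.
Qed.

(** Grouping equal letters, the expectation factors over edges, and each edge that occurs
    contributes one factor [p / beta^2]. *)
Lemma expect_word_le (es : seq E) :
  `|expect (fun w => \prod_(e <- es) y e (w e))|
    <= beta ^+ size es * (p / beta ^+ 2) ^+ size (undup es).
Proof.
have b0 : 0 < beta by apply: lt_le_trans beta2.
have -> : expect (fun w => \prod_(e <- es) y e (w e)) =
    expect (fun w => \prod_e y e (w e) ^+ count_mem e es).
  by apply: eq_bigr => w _; rewrite (prod_seq_count (fun e => y e (w e))).
rewrite (expect_prod (fun e b => y e b ^+ count_mem e es)) normr_prod.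
have -> : beta ^+ size es = \prod_(e <- es) beta.
  by rewrite big_const_seq count_predT -Monoid.iteropE.
rewrite (prod_seq_count (fun=> beta)) -prod_mem_undup -big_split.
apply: ler_prod => e _; rewrite normr_ge0 /=.
case: ifP => [ees|/negbT ees]; first by apply: moment_le; rewrite -has_count has_pred1.
rewrite (count_memPn ees) expr0 mulr1.
under eq_bigr do rewrite expr0 mulr1.
by rewrite sum_bit_weight normr1.
Qed.

End Moments.
End Expectation.

(** The ordered pair whose bits [adj] reads, so that both directions of travel meet the same random
    bits. *)
Definition edge {n : nat} (j j' : 'I_n) : 'I_n * 'I_n :=
  if (j < j')%N then (j, j') else (j', j).

Lemma edge_inj n (j : 'I_n) : injective (edge j).
Proof.
move=> a b; rewrite /edge; do 2!case: ifP => //; move=> h1 h2 [] *; subst;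
  by rewrite ?h1 ?ltnn in h2 *.
Qed.

Lemma edgeC n (j j' : 'I_n) : edge j j' = edge j' j.
Proof. by rewrite /edge; case: ltngtP => // /val_inj ->. Qed.

(* Sum of [F] over the walks of length [L] from [v] driven by the letters of ['I_n];
   [es] accumulates the edges used, and [nxt] tells where each letter leads. *)
Fixpoint wsum {R : realType} {n : nat} (nxt : 'I_n -> 'I_n -> 'I_n) (L : nat) (v : 'I_n)
    (es : seq ('I_n * 'I_n)) (F : 'I_n -> seq ('I_n * 'I_n) -> R) : R :=
  if L is L'.+1 then \sum_v' wsum nxt L' (nxt v v') (edge v v' :: es) F else F v es.

Section WalkSums.
Variables (R : realType) (n : nat) (nxt : 'I_n -> 'I_n -> 'I_n).
Local Notation E := ('I_n * 'I_n)%type.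
Implicit Types (F G : 'I_n -> seq E -> R).

Lemma wsum_le L v es F G :
  (forall v' es', size es' = (L + size es)%N -> F v' es' <= G v' es') ->
  wsum nxt L v es F <= wsum nxt L v es G.
Proof.
elim: L v es => [|L IHL] v es FG /=; first exact: FG.
by apply: ler_sum => v' _; apply: IHL => v2 es2 sz; apply: FG; rewrite sz /= addnS.
Qed.

Lemma wsumZ a L v es F :
  wsum nxt L v es (fun v' es' => a * F v' es') = a * wsum nxt L v es F.
Proof.
elim: L v es => [|L IHL] v es //=; rewrite mulr_sumr.
by apply: eq_bigr => v' _; apply: IHL.
Qed.

Lemma expect_wsum (p eta : R) L v es (F : outcome n -> 'I_n -> seq E -> R) :
  expect p eta (fun w => wsum nxt L v es (F w)) =
  wsum nxt L v es (fun v' es' => expect p eta (fun w => F w v' es')).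
Proof.
elim: L v es => [|L IHL] v es //=; rewrite expect_sum.
by apply: eq_bigr => v' _; apply: IHL.
Qed.

(* A letter either opens a new edge, at the cost of a factor [z], or reuses one of
   the at most [K] edges already present. *)
Lemma wsum_distinct_le (z : R) K L v es : 0 <= z -> (size es + L <= K)%N ->
  wsum nxt L v es (fun _ es' => z ^+ size (undup es'))
    <= z ^+ size (undup es) * (n%:R * z + K%:R) ^+ L.
Proof.
move=> z0; elim: L v es => [|L IHL] v es /= sz; first by rewrite mulr1.
have nzK : 0 <= n%:R * z + K%:R by rewrite addr_ge0 ?mulr_ge0.
apply: (@le_trans _ _ (\sum_v' z ^+ size (undup (edge v v' :: es)) *
    (n%:R * z + K%:R) ^+ L)).
  by apply: ler_sum => v' _; apply: IHL; rewrite /= addSnnS.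
rewrite -mulr_suml exprS mulrA ler_wpM2r ?exprn_ge0 //.
apply: (@le_trans _ _ (\sum_v' z ^+ size (undup es) * (z + (edge v v' \in es)%:R))).
  apply: ler_sum => v' _ /=; case: ifP => _ /=; first by rewrite ler_peMr ?exprn_ge0 // lerDr.
  by rewrite exprSr addr0.
rewrite -mulr_sumr ler_wpM2l ?exprn_ge0 // big_split /= sumr_const card_ord mulr_natl.
rewrite lerD2l -natr_sum ler_nat.
have -> : (\sum_(i < n) (edge v i \in es) = #|[set i | edge v i \in es]|)%N.
  rewrite -sum1_card [RHS]big_mkcond; apply: eq_bigr => i _.
  by rewrite inE; case: (_ \in _).
rewrite -(card_imset _ (@edge_inj n v)).
apply: (@leq_trans (size es)); last by apply: leq_trans sz; rewrite leq_addr.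
apply: leq_trans (card_size es); apply: subset_leq_card.
by apply/fintype.subsetP => _ /imsetP[i + ->]; rewrite inE.
Qed.

(** One bound for walks and stars: [nxt] selects the shape, and the weight [c] on the endpoint can
    force a walk to close up. *)
Lemma expect_wsum_le (p eta : R) (y : E -> bool * bool -> R) (c : 'I_n -> R) L v :
  0 <= p -> p <= 1 -> 0 <= eta -> eta <= 1 ->
  (forall e, \sum_b bit_weight p eta b * y e b = 0) ->
  (forall e, \sum_b bit_weight p eta b * y e b ^+ 2 <= p) ->
  (forall e b, `|y e b| <= 2) -> (forall v', 0 <= c v' <= 1) ->
  (0 < L)%N -> 4 * L%:R <= n%:R * p ->
  expect p eta (fun w => wsum nxt L v [::]
      (fun v' es => c v' * \prod_(e <- es) y e (w e)))
    <= (2 * Num.sqrt (n%:R * p * L%:R)) ^+ L.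
Proof.
move=> p0 p1 eta0 eta1 ym yv yb cb L0 Lnp.
set h := Num.sqrt _.
have L_gt0 : 0 < L%:R :> R by rewrite ltr0n.
have hh : h ^+ 2 = n%:R * p * L%:R by rewrite sqr_sqrtr // !mulr_ge0.
have h0 : 0 < h by rewrite sqrtr_gt0 mulr_gt0 //; lra.
(* This choice balances new and reused edges, [n p / beta^2 = L], so each step costs
   [beta * 2 L = 2 h]; the hypothesis [4 L <= n p] says exactly that [beta >= 2]. *)
pose beta := h / L%:R.
have beta2 : 2 <= beta.
  rewrite ler_pdivlMr // -ler_sqr ?nnegrE ?mulr_ge0 ?(ltW h0) // hh exprMn.
  by rewrite expr2 [L%:R ^+ 2]expr2 mulrA ler_wpM2r // -natrM.
have b0 : 0 < beta by apply: lt_le_trans beta2.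
rewrite expect_wsum.
apply: (@le_trans _ _ (wsum nxt L v [::]
    (fun _ es => beta ^+ L * (p / beta ^+ 2) ^+ size (undup es)))).
  apply: wsum_le => v' es sz; rewrite expectZ.
  apply: le_trans (ler_norm _) _; rewrite normrM.
  have /andP[c0 c1] := cb v'.
  rewrite (ger0_norm c0); apply: (@le_trans _ _ (1 * `|expect p eta
      (fun w => \prod_(e <- es) y e (w e))|)); first by rewrite ler_wpM2r.
  rewrite mul1r; have := expect_word_le p0 p1 eta0 eta1 ym yv yb beta2 es.
  by rewrite sz addn0.
rewrite wsumZ.
have z0 : 0 <= p / beta ^+ 2 by rewrite divr_ge0 // exprn_ge0 // ltW.
apply: (@le_trans _ _ (beta ^+ L * (n%:R * (p / beta ^+ 2) + L%:R) ^+ L)).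
  rewrite ler_wpM2l ?exprn_ge0 ?(ltW b0) //.
  by have := @wsum_distinct_le _ L L v [::] z0 (leqnn _); rewrite /= mul1r.
rewrite -exprMn le_eqVlt (_ : beta * _ = 2 * h) ?eqxx //.
have -> : beta * (n%:R * (p / beta ^+ 2) + L%:R) = n%:R * p * L%:R / h + h.
  by rewrite /beta; field; rewrite !gt_eqF.
by rewrite -hh expr2 mulfK ?gt_eqF //; ring.
Qed.

End WalkSums.

(** Walk expansion of a matrix power; the prefix [es] is general for the sake of the induction. *)
Lemma wsum_mulmx (R : realType) n (f : 'I_n * 'I_n -> R) L (v j : 'I_n) es :
  wsum (fun _ v' => v') L v es (fun v' es' => (v' == j)%:R * \prod_(e <- es') f e) =
  \prod_(e <- es) f e * ((\matrix_(a, b) f (edge a b) : 'M[R]_n) ^+ L) v j.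
Proof.
elim: L v es => [|L IHL] v es /=.
  by rewrite expr0 mxE mulrC.
rewrite exprS -mulmxE mxE mulr_sumr; apply: eq_bigr => v' _.
by rewrite IHL big_cons mxE; ring.
Qed.

(** When every letter leads back to [v], the letters are independent choices and the sum is a power
    of a row sum. *)
Lemma wsum_star (R : realType) n (f : 'I_n * 'I_n -> R) L (v : 'I_n) es :
  wsum (fun v _ => v) L v es (fun _ es' => 1 * \prod_(e <- es') f e) =
  \prod_(e <- es) f e * (\sum_v' f (edge v v')) ^+ L.
Proof.
elim: L v es => [|L IHL] v es /=; first by rewrite mul1r expr0 mulr1.
rewrite exprS mulr_suml mulr_sumr; apply: eq_bigr => v' _.
by rewrite IHL big_cons; ring.
Qed.

(** * Concentration of the adjacency matrix and of the degrees *)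

Section Model.
Variables (R : realType) (n k : nat) (cl : 'I_n -> 'I_k) (p eta : R).
Hypotheses (p0 : 0 <= p) (p1 : p <= 1) (eta0 : 0 <= eta) (eta1 : eta <= 1 / 2).

Definition sgn (j j' : 'I_n) : R := if cl j == cl j' then 1 else -1.

Definition mean_adj : 'M[R]_n :=
  \matrix_(j, j') if j == j' then 0 else sgn j j' * (p * (1 - 2 * eta)).

(** Zero on loops, because the sample space has bits for the pairs [(j, j)] and the walks may use
    them. *)
Definition adj_noise (e : 'I_n * 'I_n) (b : bool * bool) : R :=
  if e.1 == e.2 then 0 else
  sgn e.1 e.2 * ((if b.1 then if b.2 then -1 else 1 else 0) - p * (1 - 2 * eta)).

Definition deg_noise (e : 'I_n * 'I_n) (b : bool * bool) : R :=
  if e.1 == e.2 then 0 else b.1%:R - p.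

Lemma sgnC j j' : sgn j j' = sgn j' j.
Proof. by rewrite /sgn eq_sym. Qed.

Lemma adj_noiseE w :
  adj R cl w - mean_adj = \matrix_(j, j') adj_noise (edge j j') (w (edge j j')).
Proof.
apply/matrixP => j j'; rewrite !mxE /adj_noise.
have -> : ((edge j j').1 == (edge j j').2) = (j == j').
  by rewrite /edge; case: ifP => _ //=; rewrite eq_sym.
case: eqP => [_|/eqP ne]; first by rewrite subr0.
have -> : sgn (edge j j').1 (edge j j').2 = sgn j j'.
  by rewrite /edge; case: ifP => _ //=; rewrite sgnC.
rewrite -/(edge j j') -/(sgn j j') [RHS]mulrBr; congr (_ - _).
by case: ifP => _; rewrite ?mulr0.
Qed.

Lemma deg_noiseE w j : sdeg (adj R cl w) j - p * (n.-1)%:R =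
  \sum_j' deg_noise (edge j j') (w (edge j j')).
Proof.
have -> : p * (n.-1)%:R = \sum_(j' | j' != j) p.
  rewrite sumr_const -[RHS]mulr_natr; congr (_ * _%:R).
  by have := cardC1 j; rewrite card_ord => <-; apply: eq_card => i; rewrite !inE.
rewrite /sdeg (bigD1 j) //= [in RHS](bigD1 j) //= -addrA -sumrB.
congr (_ + _); last first.
  apply: eq_bigr => j' j'j; rewrite mxE /deg_noise.
  have -> : ((edge j j').1 == (edge j j').2) = false.
    by rewrite /edge; case: ifP => _ /=; apply/negbTE; rewrite 1?eq_sym // eq_sym.
  rewrite eq_sym (negPf j'j) -/(edge j j'); congr (_ - _).
  case: ifP => _ /=; rewrite ?normr0 // normrM.
  by do 2!case: ifP => _; rewrite ?normrN1 ?normr1 ?mulr1.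
by rewrite mxE /deg_noise /edge ltnn /= !eqxx normr0.
Qed.

Lemma adj_noise_mean e : \sum_b bit_weight p eta b * adj_noise e b = 0.
Proof. by rewrite sum_bits /bit_weight /adj_noise /=; case: ifP => _; ring. Qed.

Lemma adj_noise_var e : \sum_b bit_weight p eta b * adj_noise e b ^+ 2 <= p.
Proof.
rewrite sum_bits /bit_weight /adj_noise /=; case: ifP => _; first by rewrite expr0n !mulr0 !addr0.
set m := p * (1 - 2 * eta).
rewrite [X in X <= _](_ : _ = sgn e.1 e.2 ^+ 2 * (p - m ^+ 2)); last by rewrite /m; ring.
have -> : sgn e.1 e.2 ^+ 2 = 1 by rewrite /sgn; case: ifP => _; rewrite ?sqrrN expr1n.
by rewrite mul1r gerBl sqr_ge0.
Qed.

Lemma adj_noise_bound e b : `|adj_noise e b| <= 2.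
Proof.
rewrite /adj_noise; case: ifP => _; first by rewrite normr0.
have -> : forall x, `|sgn e.1 e.2 * x| = `|x|.
  by move=> x; rewrite normrM /sgn; case: ifP => _; rewrite ?normrN1 ?normr1 mul1r.
have m0 : 0 <= p * (1 - 2 * eta) by rewrite mulr_ge0 //; have := eta1; lra.
have m1 : p * (1 - 2 * eta) <= 1 by have := mulr_ge0 p0 eta0; have := p1; lra.
by rewrite ler_norml; apply/andP; split; case: ifP => _; try case: ifP => _; lra.
Qed.

Lemma deg_noise_mean e : \sum_b bit_weight p eta b * deg_noise e b = 0.
Proof. by rewrite sum_bits /bit_weight /deg_noise /=; case: ifP => _; ring. Qed.

Lemma deg_noise_var e : \sum_b bit_weight p eta b * deg_noise e b ^+ 2 <= p.
Proof.
rewrite sum_bits /bit_weight /deg_noise /=; case: ifP => _; first by rewrite expr0n !mulr0 !addr0.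
rewrite [X in X <= _](_ : _ = p - p ^+ 2); last by ring.
by rewrite gerBl sqr_ge0.
Qed.

Lemma deg_noise_bound e b : `|deg_noise e b| <= 2.
Proof.
rewrite /deg_noise; case: ifP => _; first by rewrite normr0.
have := p0; have := p1.
by rewrite ler_norml; case: b.1; rewrite ?mulr1n ?mulr0n => *; apply/andP; split; lra.
Qed.

Lemma mean_adj_sym : mean_adj^T = mean_adj.
Proof. by apply/matrixP => i j; rewrite !mxE eq_sym sgnC. Qed.

Lemma adj_sym w : (adj R cl w)^T = adj R cl w.
Proof.
apply/matrixP => i j; rewrite !mxE eq_sym; case: eqP => // /eqP ne.
by rewrite -!/(edge _ _) edgeC eq_sym.
Qed.

(** A single Markov bound on the trace of the [2q]-th power plus the [2q]-th powers of all degree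
    deviations. The [2n] terms have mean at most [h^(2q)], and the factor [expR 1] in [t] yields the
    decay [expR (- 2q)]. *)
Lemma ssbm_concentration q (A : outcome n -> Prop) :
  (0 < q)%N -> 8 * q%:R <= n%:R * p ->
  let t := expR 1 * (2 * Num.sqrt (n%:R * p * (2 * q)%:R)) in
  (forall w, opbound (adj R cl w - mean_adj) t ->
    (forall j, `|sdeg (adj R cl w) j - p * (n.-1)%:R| <= t) -> A w) ->
  1 - 2 * n%:R * expR (- (2 * q)%:R) <= prob p eta A.
Proof.
move=> q0 qnp; set h := 2 * Num.sqrt _; move=> t At.
pose L := (2 * q)%N.
have eta1' : eta <= 1 by have := eta1; lra.
have L4 : 4 * L%:R <= n%:R * p by rewrite natrM; lra.
have L0 : (0 < L)%N by rewrite muln_gt0.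
have h0 : 0 < h.
  rewrite mulr_gt0 // sqrtr_gt0 mulr_gt0 ?ltr0n //.
  by apply: lt_le_trans L4; rewrite mulr_gt0 // ltr0n.
have t0 : 0 < t by rewrite mulr_gt0 ?expR_gt0.
have even_ge0 (x : R) : 0 <= x ^+ L by rewrite exprM exprn_ge0 ?sqr_ge0.
pose M w := adj R cl w - mean_adj.
pose D w j := sdeg (adj R cl w) j - p * (n.-1)%:R.
have MT w : (M w)^T = M w by rewrite linearB /= adj_sym mean_adj_sym.
(* By symmetry this trace is the squared Frobenius norm of the [q]-th power. *)
have tr_ge0 w : 0 <= \tr (M w ^+ L).
  rewrite /L mulnC exprM expr2; set B := M w ^+ q.
  have BT : B^T = B.
    rewrite /B; elim: (q) => [|r IHr]; first by rewrite expr0 trmx1.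
    by rewrite exprS -mulmxE trmx_mul IHr MT mulmxE -exprSr exprS.
  rewrite -mulmxE -{1}BT; apply: sumr_ge0 => j _; rewrite mxE.
  by apply: sumr_ge0 => i _; rewrite mxE -expr2 sqr_ge0.
pose X w := (\tr (M w ^+ L) + \sum_j D w j ^+ L).
have EM j : expect p eta (fun w => (M w ^+ L) j j) <= h ^+ L.
  apply: le_trans (@expect_wsum_le R n (fun _ v' => v') p eta adj_noise
    (fun v' => (v' == j)%:R) L j p0 p1 eta0 eta1' adj_noise_mean adj_noise_var
    adj_noise_bound _ L0 L4); last by move=> v'; case: (v' == j); rewrite ?ler01 ?lexx.
  apply: ler_sum => w _.
  by rewrite (wsum_mulmx (fun e => adj_noise e (w e))) big_nil mul1r /M adj_noiseE.
have ED j : expect p eta (fun w => D w j ^+ L) <= h ^+ L.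
  apply: le_trans (@expect_wsum_le R n (fun v _ => v) p eta deg_noise
    (fun=> 1) L j p0 p1 eta0 eta1' deg_noise_mean deg_noise_var
    deg_noise_bound _ L0 L4); last by rewrite ler01 lexx.
  apply: ler_sum => w _.
  by rewrite (wsum_star (fun e => deg_noise e (w e))) big_nil mul1r /D deg_noiseE.
have EX : expect p eta X <= 2 * n%:R * h ^+ L.
  rewrite /X expectD (expect_sum _ _ (fun j w => D w j ^+ L)) /mxtrace.
  rewrite (expect_sum _ _ (fun j w => (M w ^+ L) j j)) -mulrA mulr_natl mulr2n.
  have sum_h : \sum_(j < n) h ^+ L = n%:R * h ^+ L by rewrite sumr_const card_ord mulr_natl.
  by rewrite -sum_h; apply: lerD; apply: ler_sum.
have tL : t ^+ L = expR L%:R * h ^+ L by rewrite exprMn -expRM_natl mulr1.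
pose g w := (t ^+ L)^-1 * X w.
have le_g : expect p eta g <= 2 * n%:R * expR (- L%:R).
  rewrite expectZ ler_pdivrMl ?exprn_gt0 // tL; apply: le_trans EX _.
  rewrite le_eqVlt expRN; apply/orP; left; apply/eqP.
  by field; rewrite gt_eqF ?expR_gt0.
apply: (@le_trans _ _ (1 - expect p eta g)); first by rewrite lerD2l lerN2.
apply: prob_ge => // w.
  by rewrite mulr_ge0 ?invr_ge0 ?exprn_ge0 ?(ltW t0) // addr_ge0 // sumr_ge0.
rewrite ltr_pdivrMl ?exprn_gt0 // mulr1 => Xt; apply: At.
  apply: (opbound_trace_pow (MT w) q0 (ltW t0)).
  by apply: le_trans (ltW Xt); rewrite lerDl sumr_ge0.
move=> j; rewrite -(@ler_pXn2r _ L) ?nnegrE ?(ltW t0) //.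
rewrite -normrX ger0_norm //; apply: le_trans (ltW Xt).
by rewrite /X (bigD1 j) //= addrCA lerDl addr_ge0 ?tr_ge0 ?sumr_ge0.
Qed.

End Model.

(** * Perturbation of the symmetric signed Laplacian *)

Section Perturbation.
Variable R : realType.

Lemma opbound_frobenius n m (X : 'M[R]_(n, m)) t : 0 <= t ->
  (forall i j, `|X i j| <= t) -> opbound X (Num.sqrt (n%:R * m%:R) * t).
Proof.
move=> t0 Xt v; rewrite vnorm_le ?mulr_ge0 ?sqrtr_ge0 ?vnorm_ge0 //.
rewrite !exprMn sqr_sqrtr ?mulr_ge0 // vnorm_sqr -!mulrA.
rewrite [X in _ <= X](_ : _ = \sum_(i < n) (m%:R * t ^+ 2) * dot v v); last first.
  by rewrite sumr_const card_ord -[RHS]mulr_natl !mulrA.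
apply: ler_sum => i _; rewrite -expr2.
have -> : (X *m v) i 0 = dot (row i X)^T v.
  by rewrite mxE; apply: eq_bigr => j _; rewrite !mxE.
rewrite -(real_normK (num_real (dot _ _))).
have CS : `|dot (row i X)^T v| <= vnorm (row i X)^T * vnorm v.
  rewrite ler_norml dot_le_vnorm andbT lerNl -dotNl.
  by apply: le_trans (dot_le_vnorm _ _) _; rewrite -scaleN1r vnormZ normrN1 mul1r.
apply: (@le_trans _ _ ((vnorm (row i X)^T * vnorm v) ^+ 2)).
  by rewrite lerXn2r ?nnegrE ?mulr_ge0 ?vnorm_ge0.
rewrite exprMn !vnorm_sqr ler_wpM2r ?dot_ge0 //.
rewrite [X in _ <= X](_ : _ = \sum_(j < m) t ^+ 2); last first.
  by rewrite sumr_const card_ord -[RHS]mulr_natl.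
apply: ler_sum => j _; rewrite !mxE -expr2 -(real_normK (num_real (X i j))).
by rewrite lerXn2r ?nnegrE.
Qed.

(** The rescaled matrix [H], that is [sqrt d] times [Dinvsqrt A], lies within [t / d] of the
    identity, so replacing [A0] by [H A H] costs three small terms. *)
Lemma Lsym_perturbation n (A A0 : 'M[R]_n) (d t : R) :
  0 < d -> 0 <= t -> 10 * t <= d ->
  opbound (A - A0) t -> opbound A0 (6 / 5 * d) ->
  (forall j, `|sdeg A j - d| <= t) ->
  opbound ((1%:M - d^-1 *: A0) - Lsym A) (4 * (t / d)).
Proof.
move=> d0 t0 td At A0d degt.
pose h j := Num.sqrt d * (Num.sqrt (sdeg A j))^-1.
pose H := diag_mx (\row_j h j).
pose tau := t / d.
have tau0 : 0 <= tau by rewrite divr_ge0 // ltW.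
have tau1 : tau <= 1 / 10 by rewrite ler_pdivrMr //; lra.
have tE : t = tau * d by rewrite divfK ?gt_eqF.
have sd0 : 0 < Num.sqrt d by rewrite sqrtr_gt0.
have hb j : `|h j - 1| <= tau.
  have := degt j; rewrite ler_norml => /andP[l1 l2].
  (* No vertex is isolated here, so the convention for the inverse of 0 does not intervene. *)
  have D0 : 0 < sdeg A j by nra.
  have h0 : 0 < h j by rewrite mulr_gt0 ?invr_gt0 ?sqrtr_gt0.
  have hh : h j ^+ 2 * sdeg A j = d.
    rewrite exprMn exprVn !sqr_sqrtr ?(ltW d0) ?(ltW D0) //.
    by rewrite divfK ?gt_eqF.
  rewrite ler_norml; apply/andP; split.
  - rewrite leNgt; apply/negP => hlt.
    have hs : h j ^+ 2 < (1 - tau) ^+ 2 by rewrite ltrXn2r ?nnegrE //; lra.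
    have h1 : d < (1 - tau) ^+ 2 * sdeg A j by rewrite -hh ltr_pM2r.
    have h2 : (1 - tau) ^+ 2 * sdeg A j <= (1 - tau) ^+ 2 * ((1 + tau) * d).
      by rewrite ler_wpM2l ?sqr_ge0 //; lra.
    have : (1 - tau) ^+ 2 * (1 + tau) <= 1 by nra.
    nra.
  - rewrite leNgt; apply/negP => hlt.
    have hs : (1 + tau) ^+ 2 < h j ^+ 2 by rewrite ltrXn2r ?nnegrE //; lra.
    have h1 : (1 + tau) ^+ 2 * sdeg A j < d by rewrite -hh ltr_pM2r.
    have h2 : (1 + tau) ^+ 2 * ((1 - tau) * d) <= (1 + tau) ^+ 2 * sdeg A j.
      by rewrite ler_wpM2l ?sqr_ge0 //; lra.
    have : 1 <= (1 + tau) ^+ 2 * (1 - tau) by nra.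
    nra.
have H1 : opbound (H - 1%:M) tau.
  have -> : H - 1%:M = diag_mx (\row_j (h j - 1)).
    by rewrite -diag_const_mx -linearB; congr diag_mx; apply/rowP => j; rewrite !mxE.
  by apply: opbound_diag => // j; rewrite mxE.
have H2 : opbound H (1 + tau).
  rewrite -[H](subrK 1%:M) addrC; apply: opboundD H1.
  by apply: opbound_isometry; rewrite trmx1 mul1mx.
have DE : Dinvsqrt A = (Num.sqrt d)^-1 *: H.
  apply/matrixP => i j; rewrite !mxE /h.
  by rewrite mulrnAr (mulKf (lt0r_neq0 sd0)).
have LE : (1%:M - d^-1 *: A0) - Lsym A =
    d^-1 *: (H *m (A - A0) *m H + (H - 1%:M) *m A0 *m H + A0 *m (H - 1%:M)).
  rewrite /Lsym DE opprB addrC -!scalemxAl -!scalemxAr scalerA.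
  have -> : (Num.sqrt d)^-1 * (Num.sqrt d)^-1 = d^-1.
    by rewrite -invfM -expr2 sqr_sqrtr // ltW.
  rewrite addrA subrK -scalerBr; congr (_ *: _).
  rewrite !(mulmxBl, mulmxBr) mul1mx mulmx1.
  by rewrite !addrA !subrK.
rewrite LE.
apply: (@opbound_le _ _ _ _ (`|d^-1| * ((1 + tau) * t * (1 + tau) +
   tau * (6 / 5 * d) * (1 + tau) + 6 / 5 * d * tau))).
  rewrite ger0_norm ?invr_ge0 ?(ltW d0) // ler_pdivrMl //.
  rewrite -/tau tE.
  (* The origin of the constant 4: at [tau = 1/10] the left side is 3.73. *)
  have f1 : (1 + tau) ^+ 2 + 6 / 5 * (1 + tau) + 6 / 5 <= 4 by nra.
  have f2 : 0 <= d * tau by rewrite mulr_ge0 // ltW.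
  have := ler_wpM2l f2 f1; lra.
have s0 : 0 <= 6 / 5 * d by lra.
have p0 : 0 <= 1 + tau by lra.
apply: opboundZ; apply: opboundD; last exact: opboundM.
by apply: opboundD; [apply: opboundM (opboundM p0 H2 At) H2 |
  apply: opboundM (opboundM tau0 H1 A0d) H2]; rewrite mulr_ge0.
Qed.

Lemma eigvecs_diag n m (M : 'M[R]_n) (V : 'M[R]_(n, m)) (s : seq R) :
  (forall j : 'I_m, M *m col j V = s`_j *: col j V) ->
  M *m V = V *m diag_mx (\row_j s`_j).
Proof.
move=> MV; apply/matrixP => i j.
have := MV j => /colP/(_ i); rewrite mul_mx_diag !mxE => h.
rewrite mulrC -[RHS]h; apply: eq_bigr => l _; by rewrite !mxE.
Qed.

Lemma isometry_leq n m (U : 'M[R]_(n, m)) : U^T *m U = 1%:M -> (m <= n)%N.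
Proof.
move=> UU; rewrite -[m](mxrank1 R) -UU.
by apply: leq_trans (mxrankM_maxr _ _) (rank_leq_row _).
Qed.

(** Testing [L] on the range of [U] puts its [m] smallest eigenvalues below [a + t]; the gap to [b]
    feeds [sin_theta], and [procrustes] doubles the result. *)
Lemma eigenspace_perturbation n m (L L0 : 'M[R]_n) (V U : 'M[R]_(n, m)) (mu : 'rV[R]_m)
    (a b t : R) :
  L^T = L -> bottom_eigvecs L V -> U^T *m U = 1%:M -> L0 *m U = U *m diag_mx mu ->
  (forall i, mu 0 i <= a) ->
  (forall w, U^T *m w = 0 -> b * dot w w <= dot w (L0 *m w)) ->
  0 <= t -> opbound (L0 - L) t -> a + t < b -> t / (b - (a + t)) < 1 ->
  exists O : 'M[R]_m, orthogonal_mx O /\ opbound (V - U *m O) (2 * (t / (b - (a + t)))).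
Proof.
move=> LT [VV [s [sz srt chL LV]]] UU L0U mu_a L0b t0 Lt atb t1.
have [Q [QQ LE]] := sym_diag LT chL.
apply: procrustes => //; first by rewrite divr_ge0 // subr_ge0 ltW.
apply: (@sin_theta _ _ _ L L0 V U (\row_j s`_j) (diag_mx mu)) => //.
  exact: eigvecs_diag.
move=> i; rewrite mxE.
have mn := isometry_leq UU.
have im := ltn_ord i.
have m0 : (m.-1 < m)%N by rewrite prednK // (leq_trans _ im).
apply: (@le_trans _ _ s`_m.-1).
  apply: (sorted_leq_nth le_trans le_refl 0 srt); rewrite ?inE ?sz.
  - exact: leq_trans im mn.
  - exact: leq_trans m0 mn.
  - by rewrite -ltnS prednK // (leq_trans _ im).
apply: (courant_fischer (A := U) QQ LE sz srt m0 (leq_trans m0 mn)).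
  by move=> y Uy0; rewrite -[y]mul1mx -UU -mulmxA Uy0 mulmx0.
move=> y; rewrite -[L](subrK L0) mulmxDl dotDr mulrDl addrC lerD //.
  rewrite (mulmxA L0) L0U -(mulmxA U) !dot_isometry // dot_diag /dot mulr_sumr.
  by apply: ler_sum => l _; rewrite -expr2 ler_wpM2r ?sqr_ge0.
apply: le_trans (dot_le_vnorm _ _) _; rewrite -vnorm_sqr expr2 mulrCA.
rewrite ler_wpM2l ?vnorm_ge0 // -opprB mulNmx -scaleN1r vnormZ normrN1 mul1r.
exact: Lt.
Qed.

(** The hyperplane orthogonal to [u] bounds the [m] smallest eigenvalues by [a], and [x] forces the
    last one above [b]. What is orthogonal to [V] is then the line of the top eigenvector. *)
Lemma bottom_complement m (S : 'M[R]_m.+1) (V : 'M[R]_(m.+1, m)) (u x : 'cV[R]_m.+1)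
    (a b : R) :
  (0 < m)%N -> S^T = S -> bottom_eigvecs S V -> a < b ->
  (forall z, dot u z = 0 -> dot z (S *m z) <= a * dot z z) ->
  x != 0 -> b * dot x x <= dot x (S *m x) ->
  exists mu : 'rV[R]_m, [/\ S *m V = V *m diag_mx mu, forall i, mu 0 i <= a &
    forall z, V^T *m z = 0 -> b * dot z z <= dot z (S *m z)].
Proof.
move=> m0 ST [VV [s [sz srt chS SV]]] ab Sa x0 Sx.
have [Q [QQ SE]] := sym_diag ST chS.
have SVd := eigvecs_diag SV.
have sa : s`_m.-1 <= a.
  (* The rows of [K] form a basis of the hyperplane, of dimension at least [m]. *)
  pose K := row_base (kermx u).
  have rK : (m <= \rank (kermx u))%N.
    by rewrite mxrank_ker; have := rank_leq_col u; lia.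
  apply: (@courant_fischer _ _ _ S Q s K^T m.-1 a QQ SE sz srt).
  - by rewrite prednK.
  - by rewrite prednK // ltnW.
  - move=> y /(congr1 trmx); rewrite trmx_mul trmxK trmx0 => yK.
    apply: trmx_inj; rewrite trmx0; apply: (row_free_inj (row_base_free (kermx u))).
    by rewrite yK mul0mx.
  - move=> y; apply: Sa; rewrite dotC dotE trmx_mul trmxK.
    have /sub_kermxP -> : (y^T *m K <= kermx u)%MS.
      by apply: submx_trans (submxMl _ _) _; rewrite eq_row_base.
    by rewrite mxE.
have sb : b <= s`_m.
  rewrite -(ler_pM2r (dot_gt0 x0)); apply: le_trans Sx _; rewrite SE dot_spectral.
  rewrite (dot_orthogonal x QQ) mulr_sumr; apply: ler_sum => i _.
  rewrite ler_wpM2r ?sqr_ge0 // mxE.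
  by apply: (sorted_leq_nth le_trans le_refl 0 srt); rewrite ?inE ?sz // -ltnS.
have s_le (i : 'I_m) : s`_i <= a.
  apply: le_trans sa; apply: (sorted_leq_nth le_trans le_refl 0 srt); rewrite ?inE ?sz.
  - by rewrite ltnS ltnW.
  - by rewrite prednK // ltnW.
  - by rewrite -ltnS prednK.
exists (\row_j s`_j); split=> // [i|z Vz]; first by rewrite mxE.
pose q := Q *m delta_mx ord_max 0 : 'cV[R]_m.+1.
have qq : dot q q = 1.
  rewrite dot_isometry // /dot (bigD1 ord_max) //=.
  rewrite big1 => [|j jm]; rewrite !mxE ?eqxx ?mulr1 ?addr0 //.
  by rewrite (negPf jm) mul0r.
have Sq : S *m q = s`_m *: q.
  rewrite SE /q -!mulmxA (mulmxA Q^T) QQ mul1mx scalemxAr; congr (_ *m _).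
  by apply/colP => i; rewrite mul_diag_mx !mxE; case: eqP => [->|_]; rewrite ?mulr0.
(* The columns of [V] need not be columns of [Q]; orthogonality to [q] comes from the separation of
   the eigenvalues by [a < b]. *)
have Vq : V^T *m q = 0.
  apply/colP => j; rewrite [RHS]mxE.
  have -> : (V^T *m q) j 0 = dot (col j V) q.
    by rewrite mxE; apply: eq_bigr => i _; rewrite !mxE.
  have : dot (S *m col j V) q = dot (col j V) (S *m q) by rewrite dot_mulmxl ST.
  rewrite SV Sq dotZl dotZr => /eqP; rewrite -subr_eq0 -mulrBl mulf_eq0 subr_eq0.
  case/orP => [/eqP h|/eqP //].
  by have := s_le j; rewrite h leNgt (lt_le_trans ab sb).
clearbody q; pose P : 'M[R]_(1 + m) := row_mx q V.
have PP : P^T *m P = 1%:M.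
  rewrite tr_row_mx mul_col_row VV Vq scalar_mx_block; congr block_mx.
    by rewrite [LHS]mx11_scalar -dotE qq.
  by rewrite -[LHS]trmxK trmx_mul trmxK Vq trmx0.
have zE : z = dot q z *: q.
  rewrite -{1}[z]mul1mx -(mulmx1C PP) tr_row_mx mul_row_col mulmxDl -!mulmxA Vz mulmx0 addr0.
  by rewrite [q^T *m z]mx11_scalar -dotE mul_mx_scalar.
rewrite zE -scalemxAr Sq !dotZl !dotZr qq mulr1.
rewrite mulr1 [X in _ <= X]mulrA [X in _ <= X]mulrC.
by rewrite ler_wpM2r // -expr2 sqr_ge0.
Qed.

End Perturbation.

(** * The mean Laplacian *)

Section Population.
Variables (R : realType) (n k : nat) (cl : 'I_n -> 'I_k) (p eta : R).
Hypothesis cl_surj : forall i, exists j, cl j = i.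
Local Notation Th := (Theta R cl).
Local Notation size_ i := ((csize cl i)%:R : R).

(** The common factor of the entries of [Bbar]; the [alpha] of [Cbar] is [1 + pop_kappa]. *)
Definition pop_kappa : R := p / (p * (n.-1)%:R) * (1 - 2 * eta).
Definition pop_u : 'cV[R]_k := \col_i Num.sqrt (size_ i).
Definition pop_block : 'M[R]_k := diag_mx (\row_i (2 * size_ i)) - pop_u *m pop_u^T.
Local Notation kappa := pop_kappa.

Lemma csize_gt0 i : 0 < size_ i.
Proof.
rewrite ltr0n; have [j clj] := cl_surj i.
by apply/card_gt0P; exists j; rewrite inE clj.
Qed.

Lemma sqrt_csize_gt0 i : 0 < Num.sqrt (size_ i).
Proof. by rewrite sqrtr_gt0 csize_gt0. Qed.

Lemma sum_csize : (\sum_i csize cl i = n)%N.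
Proof.
rewrite -[RHS](card_ord n) -sum1_card (partition_big cl xpredT) //=.
by apply: eq_bigr => i _; rewrite sum1_card; apply: eq_card => j; rewrite !inE.
Qed.

Lemma Theta_mulmx r (X : 'M[R]_(k, r)) j i :
  (Th *m X) j i = (Num.sqrt (size_ (cl j)))^-1 * X (cl j) i.
Proof.
rewrite mxE (bigD1 (cl j)) //= big1 ?addr0 => [|l lj]; rewrite mxE ?eqxx //.
by rewrite eq_sym (negPf lj) mul0r.
Qed.

Lemma Theta_orthonormal : Th^T *m Th = 1%:M.
Proof.
apply/matrixP => i i'; rewrite [RHS]mxE mxE.
have [<-|ne] := eqVneq i i'; last first.
  apply: big1 => j _; rewrite !mxE; case: eqP => [->|_]; last by rewrite mul0r.
  by rewrite (negPf ne) mulr0.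
transitivity (\sum_(j | cl j == i) (size_ i)^-1).
  rewrite [RHS]big_mkcond; apply: eq_bigr => j _; rewrite !mxE.
  case: eqP => _; last by rewrite mul0r.
  by rewrite -invfM -expr2 sqr_sqrtr // ltW ?csize_gt0.
rewrite sumr_const (_ : #|_| = csize cl i) ?mulr1n.
  by rewrite -[LHS]mulr_natl divff // gt_eqF ?csize_gt0.
by apply: eq_card => j; rewrite !inE.
Qed.

Lemma CbarE : Cbar cl p eta = (1 + kappa)%:M - kappa *: pop_block.
Proof.
rewrite /Cbar; congr (_ - _); apply/matrixP => i i'; rewrite !mxE big_ord1 !mxE.
case: eqP => [<-|_]; last by rewrite mulr0n sqrtrM // /kappa; ring.
rewrite mulr1n -expr2 sqr_sqrtr // /kappa; ring.
Qed.

(** The sandwiched block matrix has entries [sgn], with 1 on the diagonal where [mean_adj] has 0;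
    the extra [kappa] in the scalar part compensates. *)
Lemma mean_laplacianE : (0 < p) -> (1 < n)%N ->
  1%:M - (p * (n.-1)%:R)^-1 *: mean_adj cl p eta =
  (1 + kappa)%:M - kappa *: (Th *m pop_block *m Th^T).
Proof.
move=> p0 n1; have n0 : (n.-1)%:R != 0 :> R by rewrite pnatr_eq0 -lt0n -subn1 subn_gt0.
apply/matrixP => j j'; rewrite !mxE.
have -> : \sum_l (Th *m pop_block) j l * Th^T l j' = sgn R cl j j'.
  have -> : \sum_l (Th *m pop_block) j l * Th^T l j' = ((Th *m (Th *m pop_block)^T)^T) j j'.
    by rewrite trmx_mul trmxK mxE.
  rewrite mxE Theta_mulmx mxE Theta_mulmx !mxE big_ord1 !mxE.
  have s1 := sqrt_csize_gt0 (cl j); have s2 := sqrt_csize_gt0 (cl j').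
  rewrite /sgn; case: eqP => [<-|_]; last first.
    by rewrite mulr0n; field; rewrite !gt_eqF.
  rewrite mulr1n -[2 * size_ (cl j)](congr1 _ (sqr_sqrtr (ltW (csize_gt0 (cl j))))).
  by field; rewrite gt_eqF.
have [<-|ne] := eqVneq j j'.
  by rewrite /sgn eqxx !mulr1n; ring.
rewrite !mulr0n /kappa; field.
by rewrite n0 gt_eqF.
Qed.

Lemma dot_pop_block z :
  dot z (pop_block *m z) = 2 * (\sum_i size_ i * z i 0 ^+ 2) - dot pop_u z ^+ 2.
Proof.
rewrite mulmxBl dotDr dotNr dot_diag mulr_sumr; congr (_ - _).
  by apply: eq_bigr => i _; rewrite mxE mulrA.
by rewrite -mulmxA [pop_u^T *m z]mx11_scalar -dotE mul_mx_scalar dotZr dotC expr2.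
Qed.

Lemma pop_block_sym : pop_block^T = pop_block.
Proof. by rewrite linearB /= tr_diag_mx trmx_mul trmxK. Qed.

Lemma Cbar_sym : (Cbar cl p eta)^T = Cbar cl p eta.
Proof. by rewrite CbarE linearB /= linearZ /= tr_scalar_mx pop_block_sym. Qed.

Lemma dot_Cbar z : dot z (Cbar cl p eta *m z) =
  (1 + kappa) * dot z z - kappa * dot z (pop_block *m z).
Proof. by rewrite CbarE mulmxBl dotDr dotNr mul_scalar_mx -scalemxAl !dotZr. Qed.

Lemma Cbar_le_orthogonal N z : 0 <= kappa -> (forall i, N <= size_ i) ->
  dot pop_u z = 0 ->
  dot z (Cbar cl p eta *m z) <= (1 + kappa - kappa * (2 * N)) * dot z z.
Proof.
move=> k0 hN uz; rewrite dot_Cbar dot_pop_block uz expr0n subr0 mulrBl.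
rewrite lerD2l lerN2 -mulrA ler_wpM2l // -mulrA ler_wpM2l // mulr_sumr.
by apply: ler_sum => i _; rewrite -expr2 ler_wpM2r ?sqr_ge0.
Qed.

Lemma Cbar_test_vector : 0 <= kappa -> (2 <= k)%N -> exists2 x : 'cV[R]_k, x != 0 &
  (1 + kappa) * dot x x <= dot x (Cbar cl p eta *m x).
Proof.
(* For this vector the form of [pop_block] equals [2 k - k^2], nonpositive as soon as [k >= 2]. *)
move=> k0 k2; pose x : 'cV[R]_k := \col_i (Num.sqrt (size_ i))^-1.
exists x.
  apply/eqP => /colP/(_ (Ordinal (ltnW k2))); rewrite !mxE => /eqP.
  by rewrite invr_eq0 gt_eqF ?sqrt_csize_gt0.
rewrite dot_Cbar lerBrDl gerDr mulr_ge0_le0 // dot_pop_block.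
have -> : \sum_i size_ i * x i 0 ^+ 2 = k%:R.
  rewrite -[RHS]mulr1 mulr_natl -[in RHS](card_ord k) -sumr_const.
  apply: eq_bigr => i _; rewrite mxE exprVn sqr_sqrtr ?(ltW (csize_gt0 i)) //.
  by rewrite divff // gt_eqF ?csize_gt0.
have -> : dot pop_u x = k%:R.
  rewrite -[RHS]mulr1 mulr_natl -[in RHS](card_ord k) -sumr_const.
  by apply: eq_bigr => i _; rewrite !mxE divff // gt_eqF ?sqrt_csize_gt0.
have : 2 <= k%:R :> R by rewrite ler_nat.
nra.
Qed.

Lemma mean_laplacian_Theta : 0 < p -> (1 < n)%N ->
  (1%:M - (p * (n.-1)%:R)^-1 *: mean_adj cl p eta) *m Th = Th *m Cbar cl p eta.
Proof.
move=> p0 n1; rewrite mean_laplacianE // CbarE mulmxBl [RHS]mulmxBr scalar_mxC.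
by rewrite -scalemxAl -!mulmxA Theta_orthonormal mulmx1 scalemxAr.
Qed.

(** Splitting along the range of [Theta]: the difference of squared norms is that of the orthogonal
    component. *)
Lemma dot_mean_laplacian w : 0 < p -> (1 < n)%N ->
  dot w ((1%:M - (p * (n.-1)%:R)^-1 *: mean_adj cl p eta) *m w) =
  (1 + kappa) * (dot w w - dot (Th^T *m w) (Th^T *m w))
    + dot (Th^T *m w) (Cbar cl p eta *m (Th^T *m w)).
Proof.
move=> p0 n1; rewrite mean_laplacianE // dot_Cbar mulmxBl dotDr dotNr.
rewrite mul_scalar_mx -scalemxAl !dotZr -!mulmxA (dot_mulmxr Th); ring.
Qed.

Lemma mean_adj_opbound : 0 <= p -> 0 <= eta -> eta <= 1 / 2 ->
  opbound (mean_adj cl p eta) (n%:R * p).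
Proof.
move=> p0 eta0 eta1.
have -> : n%:R = Num.sqrt (n%:R * n%:R) :> R by rewrite -expr2 sqrtr_sqr ger0_norm.
apply: opbound_frobenius => // i j; rewrite mxE; case: ifP => _; first by rewrite normr0.
have -> : `|sgn R cl i j * (p * (1 - 2 * eta))| = p * (1 - 2 * eta).
  rewrite normrM /sgn (ger0_norm (_ : 0 <= p * _)); last by rewrite mulr_ge0 //; lra.
  by case: ifP => _; rewrite ?normrN1 ?normr1 mul1r.
by rewrite ler_piMr //; lra.
Qed.

Lemma min_csize_le i : (\big[minn/n]_i' csize cl i' <= csize cl i)%N.
Proof.
have : i \in index_enum 'I_k by rewrite mem_index_enum.
elim: (index_enum _) => // l r IHr; rewrite inE big_cons geq_min.
by case/orP => [/eqP->|/IHr->]; rewrite ?leqnn ?orbT.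
Qed.

Lemma min_csize_ge : (10 <= n)%N -> (2 <= k)%N ->
  Num.sqrt (aspect R cl) > 1 - 1 / (4 * k%:R * (2 + Num.sqrt k%:R)) ->
  9 / 10 * n%:R <= k%:R * (\big[minn/n]_i csize cl i)%:R :> R.
Proof.
move=> n10 k2; rewrite /aspect.
set s : R := (\big[minn/n]_i csize cl i)%:R; set l : R := (\max_i csize cl i)%:R.
have n0 : 0 < n%:R :> R by rewrite ltr0n (leq_trans _ n10).
have kR : 2 <= k%:R :> R by rewrite ler_nat.
have sk : 1 <= Num.sqrt (k%:R : R).
  by rewrite -[X in X <= _]sqrtr1 ler_wsqrtr // ler1n ltnW.
have nl : n%:R <= k%:R * l.
  rewrite -natrM ler_nat -{1}sum_csize -[k in (k * _)%N]card_ord -sum_nat_const.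
  by apply: leq_sum => i _; apply: leq_bigmax.
have l0 : 0 < l by nra.
have -> : s / n%:R / (l / n%:R) = s / l by field; rewrite !gt_eqF.
(* With [k >= 2] and [sqrt k >= 1], the aspect ratio exceeds [(23/24)^2 > 9/10]; the largest cluster
   has at least [n / k] vertices. *)
have inv24 : 1 / (4 * k%:R * (2 + Num.sqrt k%:R)) <= 1 / 24 :> R.
  rewrite ler_pM2l // lef_pV2 ?posrE //; nra.
move=> hs; have {}hs : 23 / 24 < Num.sqrt (s / l) by lra.
have sl0 : 0 <= s / l by rewrite divr_ge0 // ltW.
have : (23 / 24) ^+ 2 < s / l by rewrite -[s / l]sqr_sqrtr // ltrXn2r ?nnegrE ?sqrtr_ge0 //; lra.
rewrite ltr_pdivlMr // => hsl.
nra.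
Qed.

End Population.

(** * Recovery of the eigenspace *)

Lemma expR1_le4 (R : realType) : expR 1 <= 4 :> R.
Proof.
have h : 1 / 2 <= expR (- (1 / 2)) :> R by apply: le_trans (expR_ge1Dx _); lra.
have e0 : 0 < expR (1 / 2) :> R by apply: expR_gt0.
have e2 : expR (1 / 2) <= 2 :> R.
  move: h; rewrite expRN -[X in _ <= X]mul1r ler_pdivlMr //; lra.
have -> : expR 1 = expR (1 / 2) * expR (1 / 2) :> R by rewrite -expRD; congr expR; field.
nra.
Qed.

(** The deterministic half: on the concentration event the mean and the sampled Laplacians are
    compared, all errors being measured in units of [th = (1 - 2 eta) / k]. *)
Lemma ssbm_recovery (R : realType) n m (cl : 'I_n -> 'I_m.+1) (p eta delta t : R)
    (w : outcome n) (Rk : 'M[R]_(m.+1, m)) (V : 'M[R]_(n, m)) :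
  (10 <= n)%N -> (0 < m)%N -> (forall i, exists j, cl j = i) ->
  0 < p -> 0 <= eta -> eta < 1 / 2 -> 0 < delta -> delta < 1 / 2 ->
  Num.sqrt (aspect R cl) > 1 - 1 / (4 * m.+1%:R * (2 + Num.sqrt m.+1%:R)) ->
  0 <= t -> t * (2 * 42 * m.+1%:R / (delta * (1 - 2 * eta))) <= 16 * (n%:R * p) ->
  opbound (adj R cl w - mean_adj cl p eta) t ->
  (forall j, `|sdeg (adj R cl w) j - p * (n.-1)%:R| <= t) ->
  bottom_eigvecs (Cbar cl p eta) Rk -> bottom_eigvecs (Lsym (adj R cl w)) V ->
  exists O : 'M[R]_m, orthogonal_mx O /\
    opnorm (V - Theta R cl *m Rk *m O) <= 2 * delta.
Proof.
move=> n10 m0 cl_surj p0 eta0 eta1 delta0 delta1 asp t0 tK At degt RkC VL.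
have := min_csize_ge n10 (m0 : (1 < m.+1)%N) asp.
set N : R := (\big[minn/n]_i csize cl i)%:R => hN.
set d := p * (n.-1)%:R in degt *.
set k : R := m.+1%:R in tK hN asp.
have k2 : 2 <= k by rewrite ler_nat.
have k0 : 0 < k by lra.
have nR : 10 <= n%:R :> R by rewrite ler_nat.
have dE : d = p * (n%:R - 1).
  by rewrite /d -{2}(prednK (leq_trans _ n10)) // -natr1 addrK.
have d0 : 0 < d by rewrite dE mulr_gt0 //; lra.
have npd : 9 * (n%:R * p) <= 10 * d by rewrite dE; nra.
have dnp : d <= n%:R * p by rewrite dE; nra.
pose g := 1 - 2 * eta; have g0 : 0 < g by rewrite /g; lra.
have g1 : g <= 1 by rewrite /g; lra.
pose th := g / k; have th0 : 0 < th by rewrite divr_gt0 //; lra.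
have gE : g = th * k by rewrite divfK // gt_eqF //; lra.
have th1 : th <= 1 / 2 by rewrite ler_pdivrMr //; lra.
(* From [84 t <= 16 n p delta th] and [n p <= 10/9 d], the ratio is at most [160 / 756 < 0.212]. *)
have tau_le : t / d <= 212 / 1000 * (delta * th).
  rewrite ler_pdivrMr //.
  have dth : 0 < delta * th by apply: mulr_gt0.
  have tK' : t * 84 <= 16 * (n%:R * p) * (delta * th).
    rewrite -ler_pdivrMr //; apply: le_trans tK.
    rewrite le_eqVlt; apply/orP; left; apply/eqP; rewrite -/g gE; field.
    by rewrite !gt_eqF //; lra.
  nra.
have td : 10 * t <= d.
  have : t / d <= 1 / 10 by nra.
  by rewrite ler_pdivrMr //; lra.
pose kap := pop_kappa n p eta.
have kapE : kap = p * g / d by rewrite /kap /pop_kappa -/d -/g mulrAC.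
have kap0 : 0 < kap by rewrite kapE divr_gt0 // mulr_gt0.
have kapN : 9 / 10 * th <= kap * N.
  rewrite kapE [X in _ <= X]mulrAC ler_pdivlMr // gE.
  have h1 := ler_wpM2l (ltW th0) dnp.
  have h2 := ler_wpM2l (ltW (mulr_gt0 p0 th0)) hN; lra.
pose T := 4 * (t / d).
have T0 : 0 <= T by rewrite mulr_ge0 // divr_ge0 // ltW.
have T_le : T <= 848 / 1000 * (delta * th) by rewrite /T; lra.
have T_le' : T <= 424 / 1000 * th by nra.
pose a := 1 + kap - kap * (2 * N).
(* The unperturbed gap [2 kap N] is at least [1.8 th] and [T] takes at most [0.424 th]; what remains
   exceeds [0.848 th], hence [sigma] below. *)
have gap : 137 / 100 * th <= 1 + kap - (a + T) by rewrite /a; lra.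
have gap0 : 0 < 1 + kap - (a + T) by lra.
have sigma : T / (1 + kap - (a + T)) <= delta.
  rewrite ler_pdivrMr //; nra.
pose L0 := 1%:M - d^-1 *: mean_adj cl p eta.
have [x x0 Cx] := Cbar_test_vector cl_surj (ltW kap0) (m0 : (1 < m.+1)%N).
have aB : a < 1 + kap by lra.
have [|mu [CRk mu_a Rk_perp]] := bottom_complement (u := pop_u R cl) m0 (Cbar_sym cl p eta) RkC aB
    _ x0 Cx.
  move=> z; apply: Cbar_le_orthogonal; first exact: ltW.
  by move=> i; rewrite ler_nat min_csize_le.
have n1 : (1 < n)%N by apply: leq_trans n10.
have TT := Theta_orthonormal R cl_surj.
have UU : (Theta R cl *m Rk)^T *m (Theta R cl *m Rk) = 1%:M.
  by rewrite trmx_mul mulmxA -(mulmxA Rk^T) TT mulmx1; case: RkC.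
have [||||||||O [OO VO]] := @eigenspace_perturbation R n m (Lsym (adj R cl w)) L0 V
    (Theta R cl *m Rk) mu a (1 + kap) T _ VL UU.
- rewrite /Lsym linearB /= trmx1 !trmx_mul tr_diag_mx adj_sym mulmxA //.
- by rewrite mulmxA mean_laplacian_Theta // -!mulmxA CRk.
- exact: mu_a.
- move=> v; rewrite trmx_mul -mulmxA => /Rk_perp.
  rewrite dot_mean_laplacian //; set z := _ *m v => hz.
  by rewrite -/kap mulrBr addrAC lerBrDr lerD2l.
- exact: T0.
- apply: Lsym_perturbation => //.
  (* Here [n p <= 10/9 d <= 6/5 d], since [n >= 10]. *)
  apply: opbound_le (mean_adj_opbound _ (ltW p0) eta0 (ltW eta1)); lra.
- lra.
- by apply: le_lt_trans sigma _; lra.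
exists O; split=> //; apply: opnorm_le; first by rewrite mulr_ge0 // ltW.
by apply: opbound_le VO; rewrite ler_pM2l.
Qed.

Theorem mainTheorem4 (R : realType) :
  exists C c : R, [/\ 0 < C, C < 43 & 0 < c] /\
  forall (n k : nat) (cl : 'I_n -> 'I_k) (p eta delta : R),
    (10 <= n)%N -> (2 <= k)%N ->
    (forall i : 'I_k, exists j : 'I_n, cl j = i) ->
    0 < p -> p <= 1 ->
    0 <= eta -> eta < 1 / 2 ->
    0 < delta -> delta < 1 / 2 ->
    Num.sqrt (aspect R cl) > 1 - 1 / (4 * k%:R * (2 + Num.sqrt k%:R)) ->
    p > (2 * C * k%:R / (delta * (1 - 2 * eta))) ^+ 2 * ln n%:R / n%:R ->
    forall Rk : 'M[R]_(k, k.-1),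
      bottom_eigvecs (Cbar cl p eta) Rk ->
      prob p eta (fun w =>
        forall V : 'M[R]_(n, k.-1),
          bottom_eigvecs (Lsym (adj R cl w)) V ->
          exists O : 'M[R]_(k.-1),
            orthogonal_mx O /\
            opnorm (V - Theta R cl *m Rk *m O) <= 2 * delta)
      >= 1 - 2 / n%:R - n%:R * expR (- (n%:R * p / c)).
Proof.
(* The value 42 is the one built into [ssbm_recovery]; [c = 1] works because the failure probability
   obtained is at most [2 / n] and the exponential term is nonnegative. *)
exists 42, 1; split; first by split; lra.
move=> n [//|m] cl p eta delta n10 m0 cl_surj p0 p1 eta0 eta1 delta0 delta1 asp.
set K := 2 * 42 * m.+1%:R / (delta * (1 - 2 * eta)) => pK Rk RkC.
have n_gt0 : 0 < n%:R :> R by rewrite ltr0n (leq_trans _ n10).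
pose l : R := ln n%:R.
have l1 : 1 <= l.
  rewrite -ler_expR lnK ?posrE //; apply: le_trans (expR1_le4 R) _.
  by rewrite ler_nat (leq_trans _ n10).
(* Then [ln n < q <= 2 ln n]: the lower bound makes [expR (- 2q)] at most [n^-2], the upper one
   gives [q K^2 <= 2 n p]. *)
pose q := (Num.truncn l).+1.
have l_ge0 : 0 <= l by lra.
have q_gt : l < q%:R by apply: truncnS_gt.
have q_le : q%:R <= 2 * l.
  have := truncn_le l; rewrite l_ge0 /q -natr1 => h; lra.
have k2 : 2 <= m.+1%:R :> R by rewrite ler_nat.
have K1 : 16 <= K.
  rewrite ler_pdivlMr ?mulr_gt0 //; last by lra.
  have : delta * (1 - 2 * eta) <= 1 / 2 by nra.
  lra.
have npK : K ^+ 2 * l < n%:R * p by rewrite [n%:R * p]mulrC -ltr_pdivrMr.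
have qnp : 8 * q%:R <= n%:R * p.
  have KK : 16 <= K ^+ 2 by nra.
  have := ler_wpM2r l_ge0 KK; lra.
have np0 : 0 < n%:R * p by rewrite mulr_gt0.
set good := fun w : outcome n => _.
have := @ssbm_concentration R n m.+1 cl p eta (ltW p0) p1 eta0 (ltW eta1) q good isT qnp.
rewrite /=; set t := expR 1 * _ => conc.
have t0 : 0 <= t by rewrite !mulr_ge0 ?sqrtr_ge0 // ltW ?expR_gt0.
(* Squared: [t^2 K^2 = 8 e^2 n p q K^2], at most [8 * 16 * 2 = 16^2] times [(n p)^2]. *)
have tK : t * K <= 16 * (n%:R * p).
  have K0 : 0 <= K by lra.
  rewrite -ler_sqr ?nnegrE; [|exact: mulr_ge0|by rewrite mulr_ge0 // ltW].
  have tt : t ^+ 2 = expR 1 ^+ 2 * (2 ^+ 2 * (n%:R * p * (2 * q%:R))).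
    by rewrite /t natrM !exprMn sqr_sqrtr // !mulr_ge0 // ltW.
  rewrite exprMn tt.
  have e4 := expR1_le4 R; have e0 := expR_gt0 (1 : R).
  have ee : expR 1 ^+ 2 <= 16 :> R by nra.
  have h1 : q%:R * K ^+ 2 <= 2 * (n%:R * p).
    have := ler_wpM2r (sqr_ge0 K) q_le; lra.
  have h2 : 0 <= q%:R * K ^+ 2 by rewrite mulr_ge0 ?sqr_ge0.
  have h3 : expR 1 ^+ 2 * (q%:R * K ^+ 2) <= 16 * (2 * (n%:R * p)).
    by apply: ler_pM => //; apply: sqr_ge0.
  have := ler_wpM2l (ltW np0) h3; lra.
apply: le_trans (conc _); last first.
  move=> w At degt V VL.
  exact: (ssbm_recovery n10 m0 cl_surj p0 eta0 eta1 delta0 delta1 asp t0 tK At degt RkC VL).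
have e_le : expR (- (2 * q)%:R) <= n%:R ^- 2 :> R.
  rewrite expRN lef_pV2 ?posrE ?expR_gt0 ?exprn_gt0 //.
  rewrite -{1}[n%:R](lnK (_ : n%:R \is Num.pos)) // -expRM_natl ler_expR natrM.
  by rewrite ler_pM2l // ltW.
have : 2 * n%:R * expR (- (2 * q)%:R) <= 2 / n%:R :> R.
  apply: (@le_trans _ _ (2 * n%:R * n%:R ^- 2)); first by rewrite ler_wpM2l ?mulr_ge0.
  by rewrite le_eqVlt; apply/orP; left; apply/eqP; field; rewrite gt_eqF.
have : 0 <= n%:R * expR (- (n%:R * p / 1)) :> R by rewrite mulr_ge0 // ltW ?expR_gt0.
lra.
Qed.
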